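(* Let $p,g_i,S,d,R,\eta_i,\beta$ be as in the context and let $h$ be the form defined there in the variables $z=(z_1,\dots,z_{n+m+3})=(x_1,\dots,x_n,s_0,\dots,s_{m+1},y)$. Then $p(x)>0$ for all $x\in S$ if and only if there exists a positive integer $r$ such that the polynomial in $(v,w)\in\mathbb{R}^{2(n+m+3)}$ $$\Big(h(v^2-w^2)-\tfrac1r\Big(\sum_{i=1}^{n+m+3}(v_i^2-w_i^2)^2\Big)^{2d}+\tfrac{1}{2r}\Big(\sum_{i=1}^{n+m+3}(v_i^4+w_i^4)\Big)^{2d}\Big)\cdot\Big(\sum_{i=1}^{n+m+3}v_i^2+\sum_{i=1}^{n+m+3}w_i^2\Big)^{r^2}$$ has nonnegative coefficients.
   Context: Let $p,g_1,\dots,g_m$ be real polynomials in $x=(x_1,\dots,x_n)$ and let $S=\{x\in\mathbb{R}^n : g_i(x)\ge 0,\ i=1,\dots,m\}$. Let $d\ge 1$ be the integer such that $2d$ is the smallest even integer larger than or equal to the maximum of the degrees of $p,g_1,\dots,g_m$. Assume there is $R>0$ with $\sum_{i=1}^n x_i^2\le R$ for all $x\in S$. Let $\eta_1,\dots,\eta_m$ be real numbers with $g_i(x)\le\eta_i$ for all $x\in S$, and let $\beta$ be a real number with $-p(x)\le\beta$ for all $x\in S$. For a polynomial $q$ in $x$ of degree at most $2d$, $y^{2d}q(x/y)$ denotes its homogenization to a form of degree $2d$ in $(x,y)$. Define $$h(x,s,y)=\big(y^{2d}p(x/y)+s_0^2y^{2d-2}\big)^2+\sum_{i=1}^m\big(y^{2d}g_i(x/y)-s_i^2y^{2d-2}\big)^2+\Big(\big(R+\textstyle\sum_{i=1}^m\eta_i+\beta\big)^d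 y^{2d}-\big(\sum_{i=1}^n x_i^2+\sum_{i=0}^m s_i^2\big)^d-s_{m+1}^{2d}\Big)^2,$$ a form of degree $4d$. $h(v^2-w^2)$ denotes $h$ evaluated at $z_i=v_i^2-w_i^2$, $i=1,\dots,n+m+3$. (The exponent $2d$ on the two added terms makes all terms homogeneous of degree $8d$; the paper's printed exponent $d$ is a typo.) *)

(* Defs.v *)
(* No multivariate polynomial library is installed, so we encode real
   polynomials in k variables x_0,...,x_{k-1} as formal finite sums of terms
   c * x^a, given as a list of pairs (c, a) with a : nat -> nat an exponent
   vector (only the entries a 0, ..., a (k-1) are meaningful).  Two lists
   denote the same polynomial iff they have the same coefficient function
   [coef k]; all notions below (coefficients, evaluation, total degree,
   homogenization, ring operations, substitution) respect this. *)
From Stdlib Require Import Reals List Arith.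
Import ListNotations.
Open Scope R_scope.

Definition mono := nat -> nat.
Definition mpoly := list (R * mono).

Definition mon_eqb (k : nat) (a b : mono) : bool :=
  forallb (fun i => Nat.eqb (a i) (b i)) (seq 0 k).
Definition mdeg (k : nat) (a : mono) : nat :=
  fold_right Nat.add 0%nat (map a (seq 0 k)).
Definition rsum (k : nat) (f : nat -> R) : R := fold_right Rplus 0 (map f (seq 0 k)).
Definition rprod (k : nat) (f : nat -> R) : R := fold_right Rmult 1 (map f (seq 0 k)).

Definition coef (k : nat) (P : mpoly) (a : mono) : R :=
  fold_right Rplus 0 (map fst (filter (fun t => mon_eqb k (snd t) a) P)).
Definition has_nonneg_coefs (k : nat) (P : mpoly) : Prop :=
  forall a : mono, 0 <= coef k P a.
Definition peval (k : nat) (P : mpoly) (x : nat -> R) : R :=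
  fold_right Rplus 0 (map (fun t => fst t * rprod k (fun i => x i ^ snd t i)) P).
(* total degree (0 for the zero polynomial) *)
Definition pdeg (k : nat) (P : mpoly) : nat :=
  fold_right Nat.max 0%nat
    (map (fun t => if Req_EM_T (coef k P (snd t)) 0 then 0%nat else mdeg k (snd t)) P).

Definition pconst (c : R) : mpoly := [(c, fun _ => 0%nat)].
Definition pvar (i : nat) : mpoly := [(1, fun j => if Nat.eqb j i then 1%nat else 0%nat)].
Definition padd (P Q : mpoly) : mpoly := P ++ Q.
Definition pscale (c : R) (P : mpoly) : mpoly := map (fun t => (c * fst t, snd t)) P.
Definition psub (P Q : mpoly) : mpoly := padd P (pscale (-1) Q).
Definition pmul (P Q : mpoly) : mpoly :=
  flat_map (fun t => map (fun u => (fst t * fst u, fun i => (snd t i + snd u i)%nat)) Q) P.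
Definition ppow (P : mpoly) (e : nat) : mpoly := Nat.iter e (pmul P) (pconst 1).
Definition psum (k : nat) (f : nat -> mpoly) : mpoly := flat_map f (seq 0 k).
Definition psubst (k : nat) (P : mpoly) (q : nat -> mpoly) : mpoly :=
  flat_map (fun t => pscale (fst t)
     (fold_right pmul (pconst 1) (map (fun i => ppow (q i) (snd t i)) (seq 0 k)))) P.
(* homogenization y^D q(x/y) of q in n variables x_0..x_{n-1} (deg q <= D),
   with the new variable y placed at index yi >= n *)
Definition homog (n yi D : nat) (P : mpoly) : mpoly :=
  map (fun t => (fst t, fun i => if Nat.ltb i n then snd t i
                                 else if Nat.eqb i yi then (D - mdeg n (snd t))%nat
                                 else 0%nat)) P.

(* Data: p, g_0, ..., g_{m-1} polynomials in x_0..x_{n-1}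
   (the paper's g_1..g_m are g 0 .. g (m-1), and eta_i is eta (i-1)). *)
Definition inS (n m : nat) (g : nat -> mpoly) (x : nat -> R) : Prop :=
  forall j, (j < m)%nat -> 0 <= peval n (g j) x.

(* d >= 1 with 2d the smallest even integer >= max degree *)
Definition maxdeg (n m : nat) (p : mpoly) (g : nat -> mpoly) : nat :=
  fold_right Nat.max (pdeg n p) (map (fun j => pdeg n (g j)) (seq 0 m)).
Definition dd (n m : nat) (p : mpoly) (g : nat -> mpoly) : nat :=
  Nat.max 1 ((maxdeg n m p g + 1) / 2).

(* The form h in z = (x_0..x_{n-1}, s_0..s_{m+1}, y), N = n+m+3 variables:
   x_i at index i, s_j at index n+j, y at index n+m+2. *)
Definition hform (n m : nat) (p : mpoly) (g : nat -> mpoly)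
    (Rb : R) (eta : nat -> R) (beta : R) : mpoly :=
  let d := dd n m p g in
  let yi := (n + m + 2)%nat in
  let y := pvar yi in
  let s j := pvar (n + j) in
  let t0 := ppow (padd (homog n yi (2 * d) p)
                       (pmul (ppow (s 0%nat) 2) (ppow y (2 * d - 2)))) 2 in
  let tg := psum m (fun j => ppow (psub (homog n yi (2 * d) (g j))
                       (pmul (ppow (s (S j)) 2) (ppow y (2 * d - 2)))) 2) in
  let c := Rb + rsum m eta + beta in
  let tl := ppow (psub (psub (pscale (c ^ d) (ppow y (2 * d)))
                   (ppow (padd (psum n (fun i => ppow (pvar i) 2))
                               (psum (S m) (fun j => ppow (s j) 2))) d))
                   (ppow (s (S m)) (2 * d))) 2 in
  padd t0 (padd tg tl).

(* The polynomial in (v, w) (2N variables: v_i at index i, w_i at index N+i)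
   ( h(v^2-w^2) - 1/r (sum (v_i^2-w_i^2)^2)^{2d} + 1/(2r) (sum (v_i^4+w_i^4))^{2d} )
     * (sum v_i^2 + sum w_i^2)^{r^2} *)
Definition cert (n m : nat) (p : mpoly) (g : nat -> mpoly)
    (Rb : R) (eta : nat -> R) (beta : R) (r : nat) : mpoly :=
  let d := dd n m p g in
  let N := (n + m + 3)%nat in
  let q i := psub (ppow (pvar i) 2) (ppow (pvar (N + i)) 2) in
  let hq := psubst N (hform n m p g Rb eta beta) q in
  let A := ppow (psum N (fun i => ppow (q i) 2)) (2 * d) in
  let B := ppow (psum N (fun i => padd (ppow (pvar i) 4) (ppow (pvar (N + i)) 4))) (2 * d) in
  let E := ppow (padd (psum N (fun i => ppow (pvar i) 2))
                      (psum N (fun i => ppow (pvar (N + i)) 2))) (r * r) in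
  pmul (padd (psub hq (pscale (/ INR r) A)) (pscale (/ (2 * INR r)) B)) E.

(* Main.v *)
(* If p > 0 on S, then h has no real zero besides 0: a zero with y <> 0 rescales to a point of S where
   p <= 0 (the squares s_i^2 are the slacks of the constraints), and a zero with y = 0 vanishes because
   the last square forces |x|^2 + sum s_i^2 = 0.  By compactness of the unit sphere, h(z) >= c |z|^{4d},
   so for 1/r <= c the even form
     F(v, w) = h(v^2 - w^2) - 1/r (sum (v_i^2 - w_i^2)^2)^{2d} + 1/(2r) (sum (v_i^4 + w_i^4))^{2d}
   is at least (2r K^{2d})^{-1} (sum v_i^2 + w_i^2)^{4d}, K = 2(n+m+3).  Polya's argument in the
   variables u = (v^2, w^2) then shows that the coefficient of F (sum u_i)^M at u^{a/2} is
   M! / prod (a_i/2)! times a falling-factorial sum lying within O(r (M + 4d)^{4d-1}) of F(sqrt (a/2)),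
   which is of order (M + 4d)^{4d} / r; the exponent M = r^2 makes every coefficient nonnegative for
   large r.
   Conversely, if p(x) <= 0 at some x in S, then h has a zero z with y = 1, and at v = sqrt z^+,
   w = sqrt z^- the certificate equals -1/(2r) |z|^{4d} (sum |z_i|)^{r^2} < 0, which is impossible for
   a polynomial with nonnegative coefficients evaluated at a nonnegative point. *)

Require Import Defs.
From Stdlib Require Import Reals List Arith Lia Lra Classical ClassicalEpsilon FunctionalExtensionality.
Import ListNotations.
Open Scope R_scope.

Definition lsum {A} (g : A -> R) (l : list A) : R := fold_right Rplus 0 (map g l).

Lemma lsum_ext {A} (g h : A -> R) l : (forall a, In a l -> g a = h a) -> lsum g l = lsum h l.
Proof. intros H. unfold lsum. f_equal. apply map_ext_in. auto. Qed.

Lemma lsum_nonneg {A} (g : A -> R) l : (forall a, In a l -> 0 <= g a) -> 0 <= lsum g l.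
Proof.
  unfold lsum. induction l as [|a l IH]; intros H; simpl; [lra|].
  assert (0 <= g a) by (apply H; left; auto).
  assert (0 <= fold_right Rplus 0 (map g l)) by (apply IH; intros; apply H; right; auto). lra.
Qed.

Lemma lsum_ge_term {A} (g : A -> R) l x : (forall a, In a l -> 0 <= g a) -> In x l -> g x <= lsum g l.
Proof.
  induction l as [|a l IH]; intros Hl Hx; [destruct Hx|]. unfold lsum in *; simpl.
  pose proof (lsum_nonneg g l ltac:(intros; apply Hl; right; auto)). unfold lsum in *.
  destruct Hx as [<-|Hx]; [lra|].
  assert (0 <= g a) by (apply Hl; left; auto).
  assert (g x <= fold_right Rplus 0 (map g l)) by (apply IH; auto; intros; apply Hl; right; auto). lra.
Qed.

Lemma lsum_const {A} (l : list A) c : lsum (fun _ => c) l = INR (length l) * c.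
Proof. unfold lsum. induction l; [simpl; ring|]. cbn [map fold_right length]. rewrite IHl, S_INR. ring. Qed.

Lemma rsum_ext_in k f g : (forall i, (i < k)%nat -> f i = g i) -> rsum k f = rsum k g.
Proof. intros H. unfold rsum. f_equal. apply map_ext_in. intros i Hi. apply in_seq in Hi. apply H. lia. Qed.

Lemma rsum_nonneg k f : (forall i, (i < k)%nat -> 0 <= f i) -> 0 <= rsum k f.
Proof. intros H. apply lsum_nonneg. intros i Hi. apply in_seq in Hi. apply H. lia. Qed.

Lemma rsum_sq_nonneg k z : 0 <= rsum k (fun i => z i ^ 2).
Proof. apply rsum_nonneg. intros; apply pow2_ge_0. Qed.

Lemma rsum_ge_term k f i : (forall j, (j < k)%nat -> 0 <= f j) -> (i < k)%nat -> f i <= rsum k f.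
Proof.
  intros H Hi. apply lsum_ge_term; [|apply in_seq; lia].
  intros j Hj. apply in_seq in Hj. apply H. lia.
Qed.

Lemma rsum_zero_each k f : (forall i, (i < k)%nat -> 0 <= f i) -> rsum k f <= 0 ->
  forall i, (i < k)%nat -> f i = 0.
Proof. intros H Hs i Hi. pose proof (rsum_ge_term k f i H Hi). pose proof (H i Hi). lra. Qed.

Lemma rsum_scal k c f : rsum k (fun i => c * f i) = c * rsum k f.
Proof. unfold rsum. induction (seq 0 k); simpl; [ring|]. rewrite IHl. ring. Qed.

Lemma rsum_add k f g : rsum k (fun i => f i + g i) = rsum k f + rsum k g.
Proof. unfold rsum. induction (seq 0 k); simpl; [ring|]. rewrite IHl. ring. Qed.

Lemma rsum_const k c : rsum k (fun _ => c) = INR k * c.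
Proof. change (lsum (fun _ => c) (seq 0 k) = INR k * c). rewrite lsum_const, length_seq. reflexivity. Qed.

Lemma rsum_le k f g : (forall i, (i < k)%nat -> f i <= g i) -> rsum k f <= rsum k g.
Proof.
  intros H. unfold rsum.
  assert (Hl : forall i, In i (seq 0 k) -> f i <= g i) by (intros i Hi; apply in_seq in Hi; apply H; lia).
  induction (seq 0 k) as [|i l IH]; simpl; [lra|].
  assert (f i <= g i) by (apply Hl; left; auto).
  assert (fold_right Rplus 0 (map f l) <= fold_right Rplus 0 (map g l)) by (apply IH; intros; apply Hl; right; auto).
  lra.
Qed.

Lemma rsum_S m f : rsum (S m) f = f 0%nat + rsum m (fun j => f (S j)).
Proof. unfold rsum. simpl. f_equal. rewrite <- seq_shift, map_map. auto. Qed.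

Lemma seq_add_map s len : seq s len = map (fun i => (s + i)%nat) (seq 0 len).
Proof.
  revert s. induction len; intros s; simpl; auto. f_equal. lia.
  rewrite IHlen, <- seq_shift, map_map. apply map_ext. intros; lia.
Qed.

Lemma map_seq_shift {A} (f : nat -> A) s len : map f (seq s len) = map (fun i => f (s + i)%nat) (seq 0 len).
Proof. rewrite seq_add_map, map_map. reflexivity. Qed.

Lemma rsum_split N f : rsum (N + N) f = rsum N f + rsum N (fun i => f (N + i)%nat).
Proof.
  unfold rsum. rewrite seq_app, map_app, fold_right_app. simpl. rewrite (map_seq_shift f 0 N) at 1.
  rewrite (map_seq_shift f N N). simpl.
  induction (map (fun i => f i) (seq 0 N)); simpl; [lra|]. rewrite IHl. lra.
Qed.

Lemma rsum_INR k f : rsum k (fun i => INR (f i)) = INR (fold_right Nat.add 0%nat (map f (seq 0 k))).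
Proof. unfold rsum. induction (seq 0 k); simpl; auto. rewrite IHl, plus_INR. auto. Qed.

Lemma sq_rsum_le k x : (0 < k)%nat -> rsum k x ^ 2 / INR k <= rsum k (fun i => x i ^ 2).
Proof.
  intros Hk. set (S := rsum k x). set (t := S / INR k).
  assert (HK : 0 < INR k) by (apply lt_0_INR; auto).
  assert (H : 0 <= rsum k (fun i => (x i - t) ^ 2)) by (apply rsum_nonneg; intros; apply pow2_ge_0).
  rewrite (rsum_ext_in k _ (fun i => x i ^ 2 + (-2 * t) * x i + t ^ 2)) in H by (intros; ring).
  rewrite !rsum_add, rsum_scal, rsum_const in H. fold S in H.
  unfold t in H. replace (S ^ 2 / INR k) with (2 * (S / INR k) * S - INR k * (S / INR k) ^ 2) by (field; lra).
  lra.
Qed.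

Lemma nonzero_of_rsum_sq_pos k z : 0 < rsum k (fun i => z i ^ 2) -> exists i, (i < k)%nat /\ z i <> 0.
Proof.
  intros H. apply NNPP. intros Hc. assert (rsum k (fun i => z i ^ 2) = 0); [|lra].
  rewrite (rsum_ext_in k _ (fun _ => 0)), rsum_const; [ring|].
  intros i Hi. destruct (Req_dec (z i) 0) as [E|E]; [rewrite E; ring| exfalso; apply Hc; exists i; auto].
Qed.

Definition lprod (l : list nat) (f : nat -> R) : R := fold_right Rmult 1 (map f l).

Lemma lprod_mul l f g : lprod l (fun i => f i * g i) = lprod l f * lprod l g.
Proof. unfold lprod; induction l; simpl; [lra|]. rewrite IHl. ring. Qed.

Lemma lprod_ext_in l f g : (forall i, In i l -> f i = g i) -> lprod l f = lprod l g.
Proof. intros H. unfold lprod. f_equal. apply map_ext_in. auto. Qed.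

Lemma lprod_one l : lprod l (fun _ => 1) = 1.
Proof. unfold lprod; induction l; simpl; [lra|]. rewrite IHl. ring. Qed.

Lemma lprod_app l1 l2 f : lprod (l1 ++ l2) f = lprod l1 f * lprod l2 f.
Proof. unfold lprod. rewrite map_app, fold_right_app. induction l1; simpl; [lra|]. rewrite IHl1. ring. Qed.

Lemma lprod_evec l i (y : R) : NoDup l ->
  lprod l (fun j => (if Nat.eqb j i then y else 1)) = if existsb (Nat.eqb i) l then y else 1.
Proof.
  unfold lprod. induction l as [|x l IH]; intros Hnd; simpl; auto. inversion Hnd; subst.
  rewrite IH by auto. rewrite (Nat.eqb_sym x i).
  destruct (Nat.eqb i x) eqn:E; simpl.
  - apply Nat.eqb_eq in E; subst. destruct (existsb (Nat.eqb x) l) eqn:E2; [|ring].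
    apply existsb_exists in E2. destruct E2 as [z [Hz Hz2]]. apply Nat.eqb_eq in Hz2; subst. contradiction.
  - ring.
Qed.

Lemma lprod_point l f i : In i l -> NoDup l ->
  lprod l f = f i * lprod l (fun j => if Nat.eqb j i then 1 else f j).
Proof.
  unfold lprod. induction l as [|x l IH]; intros Hi Hnd; [destruct Hi|]. inversion Hnd; subst. simpl.
  destruct Hi as [<-|Hi].
  - rewrite Nat.eqb_refl. f_equal. ring_simplify. f_equal. apply map_ext_in. intros j Hj.
    destruct (Nat.eqb j x) eqn:E; auto. apply Nat.eqb_eq in E; subst; contradiction.
  - destruct (Nat.eqb x i) eqn:E. { apply Nat.eqb_eq in E; subst; contradiction. }
    rewrite IH by auto. ring.
Qed.

Lemma lprod_has_zero l f i : In i l -> f i = 0 -> lprod l f = 0.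
Proof. unfold lprod. induction l; simpl; [tauto|]. intros [<-|H] Hf. rewrite Hf; ring. rewrite IHl; auto. ring. Qed.

Lemma fold_max_ge0 a l : (a <= fold_right Nat.max a l)%nat.
Proof. induction l; simpl; lia. Qed.

Lemma fold_max_ge_in a x l : In x l -> (x <= fold_right Nat.max a l)%nat.
Proof. induction l; simpl; [tauto|]. intros [->|H]; [lia|]. specialize (IHl H); lia. Qed.

Lemma fold_add_map_add (l : list nat) (a b : mono) :
  fold_right Nat.add 0%nat (map (fun i => (a i + b i)%nat) l) =
  (fold_right Nat.add 0%nat (map a l) + fold_right Nat.add 0%nat (map b l))%nat.
Proof. induction l; simpl; lia. Qed.

Lemma fold_ind_v (l : list nat) y v : NoDup l ->
  fold_right Nat.add 0%nat (map (fun i => if Nat.eqb i y then v else 0%nat) l)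
  = if existsb (Nat.eqb y) l then v else 0%nat.
Proof.
  induction l as [|x l IH]; intros Hnd; simpl; auto. inversion Hnd; subst.
  rewrite IH by auto. rewrite (Nat.eqb_sym x y).
  destruct (Nat.eqb y x) eqn:E; simpl.
  - apply Nat.eqb_eq in E; subst. destruct (existsb (Nat.eqb x) l) eqn:E2; auto.
    apply existsb_exists in E2. destruct E2 as [z [Hz Hz2]]. apply Nat.eqb_eq in Hz2; subst. contradiction.
  - lia.
Qed.

Lemma fold_zero_iff (l : list nat) (c : mono) :
  fold_right Nat.add 0%nat (map c l) = 0%nat <-> (forall i, In i l -> c i = 0%nat).
Proof.
  induction l as [|x l IH]; simpl; split; intros H.
  - tauto.
  - auto.
  - intros i [<-|Hi]; [lia|]. apply IH; auto; lia.
  - rewrite (H x (or_introl eq_refl)). rewrite (proj2 IH); auto.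
Qed.

Lemma fold_le_in (l : list nat) (f : nat -> nat) i : In i l -> (f i <= fold_right Nat.add 0%nat (map f l))%nat.
Proof. induction l; simpl; [tauto|]. intros [<-|H]; [lia|]. specialize (IHl H); lia. Qed.

Lemma half_double w : (2 * w / 2 = w)%nat.
Proof. rewrite Nat.mul_comm. apply Nat.div_mul. lia. Qed.

Lemma even_ex x : Nat.even x = true -> exists w, x = (2 * w)%nat.
Proof. intros H. apply Nat.even_spec in H. destruct H as [w Hw]. exists w. lia. Qed.

Lemma fold_half (l : list nat) (c : mono) : (forall i, In i l -> Nat.even (c i) = true) ->
  (2 * fold_right Nat.add 0%nat (map (fun i => c i / 2) l) = fold_right Nat.add 0%nat (map c l))%nat.
Proof.
  induction l as [|x l IH]; intros H; cbn [map fold_right]; auto.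
  destruct (even_ex (c x) (H x (or_introl eq_refl))) as [w Hw]. rewrite Hw. rewrite half_double.
  rewrite <- IH by (intros; apply H; right; auto). lia.
Qed.

Lemma pow_even_nonneg y k : 0 <= y ^ (2 * k).
Proof. rewrite pow_mult. apply pow_le, pow2_ge_0. Qed.

Lemma pow_even_pos y k : y <> 0 -> 0 < y ^ (2 * k).
Proof. intros H. rewrite pow_mult. apply pow_lt. pose proof (pow2_ge_0 y). pose proof (pow_nonzero y 2 H). lra. Qed.

Lemma pow_eq_0_inv x k : x ^ k = 0 -> x = 0.
Proof. intros H. destruct (Req_dec x 0); auto. exfalso. apply (pow_nonzero x k H0 H). Qed.

Lemma sqrt_pow_even x v : 0 <= x -> sqrt x ^ (2 * v) = x ^ v.
Proof. intros Hx. rewrite pow_mult, pow2_sqrt; auto. Qed.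

Lemma pow_root_exists (u : R) (e : nat) : 0 <= u -> (0 < e)%nat -> exists s, s ^ e = u.
Proof.
  intros Hu He. destruct (Req_dec u 0) as [->|Hne].
  - exists 0. apply pow_i; auto.
  - exists (Rpower u (/ INR e)). assert (0 < INR e) by (apply lt_0_INR; auto).
    rewrite <- Rpower_pow by (unfold Rpower; apply exp_pos).
    rewrite Rpower_mult. replace (/ INR e * INR e) with 1 by (field; lra). apply Rpower_1. lra.
Qed.

Lemma Rmax_pos_neg_parts u :
  Rmax u 0 - Rmax (- u) 0 = u /\ Rmax u 0 ^ 2 + Rmax (- u) 0 ^ 2 = u ^ 2 /\
  Rmax u 0 + Rmax (- u) 0 = Rabs u /\ 0 <= Rmax u 0 /\ 0 <= Rmax (- u) 0.
Proof.
  unfold Rmax, Rabs. destruct (Rle_dec u 0), (Rle_dec (- u) 0), (Rcase_abs u); repeat split; nra.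
Qed.

Lemma large_nat_exists c C : 0 < c -> exists r, (1 <= r)%nat /\ / INR r <= c /\ C < INR r.
Proof.
  intros Hc. destruct (INR_unbounded (Rmax 1 (Rmax (/ c) C))) as [r Hr].
  pose proof (Rmax_l 1 (Rmax (/ c) C)). pose proof (Rmax_r 1 (Rmax (/ c) C)).
  pose proof (Rmax_l (/ c) C). pose proof (Rmax_r (/ c) C).
  exists r. split; [destruct r; [simpl in Hr; lra| lia]|]. split; [|lra].
  rewrite <- (Rinv_inv c). apply Rinv_le_contravar; [apply Rinv_0_lt_compat; auto| lra].
Qed.

(* tsum f P pairs the term list P = [(c, a); ...] with a function f of monomials; evaluation,
   coefficients and the coefficient bounds below are all instances of it. *)
Definition tsum (f : mono -> R) (P : mpoly) : R :=
  fold_right Rplus 0 (map (fun t => fst t * f (snd t)) P).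

Definition meq (k : nat) (a b : mono) : Prop := forall i, (i < k)%nat -> a i = b i.

Definition respects (k : nat) (f : mono -> R) : Prop := forall a b, meq k a b -> f a = f b.

Lemma mon_eqb_spec k a b : mon_eqb k a b = true <-> meq k a b.
Proof.
  unfold mon_eqb, meq. rewrite forallb_forall. split.
  - intros H i Hi. apply Nat.eqb_eq. apply H. apply in_seq. lia.
  - intros H i Hi. apply in_seq in Hi. apply Nat.eqb_eq. apply H. lia.
Qed.

Lemma meq_refl k a : meq k a a. Proof. intros i _; auto. Qed.

Lemma meq_sym k a b : meq k a b -> meq k b a. Proof. intros H i Hi; symmetry; auto. Qed.

Lemma meq_trans k a b c : meq k a b -> meq k b c -> meq k a c.
Proof. intros H1 H2 i Hi; rewrite H1; auto. Qed.

Lemma mon_eqb_refl k a : mon_eqb k a a = true.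
Proof. apply mon_eqb_spec, meq_refl. Qed.

Definition mon_ind (k : nat) (a : mono) : mono -> R := fun b => if mon_eqb k b a then 1 else 0.

Lemma respects_mon_ind k a : respects k (mon_ind k a).
Proof.
  intros b c H. unfold mon_ind.
  destruct (mon_eqb k b a) eqn:E1, (mon_eqb k c a) eqn:E2; auto; exfalso.
  - apply mon_eqb_spec in E1.
    assert (meq k c a) by (eapply meq_trans; [apply meq_sym; eauto| eauto]).
    apply mon_eqb_spec in H0. congruence.
  - apply mon_eqb_spec in E2.
    assert (meq k b a) by (eapply meq_trans; eauto).
    apply mon_eqb_spec in H0. congruence.
Qed.

Lemma tsum_nil f : tsum f [] = 0. Proof. reflexivity. Qed.

Lemma tsum_cons f t P : tsum f (t :: P) = fst t * f (snd t) + tsum f P. Proof. reflexivity. Qed.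

Lemma tsum_app f P Q : tsum f (P ++ Q) = tsum f P + tsum f Q.
Proof. induction P; simpl; [unfold tsum; simpl; lra|]. rewrite !tsum_cons, IHP. lra. Qed.

Lemma tsum_ext_in f g P : (forall t, In t P -> f (snd t) = g (snd t)) -> tsum f P = tsum g P.
Proof.
  induction P as [|t P IH]; intros H; [reflexivity|].
  rewrite !tsum_cons. rewrite H by (left; auto). rewrite IH; auto. intros; apply H; right; auto.
Qed.

Lemma tsum_ext f g P : (forall b, f b = g b) -> tsum f P = tsum g P.
Proof. intros; apply tsum_ext_in; auto. Qed.

Lemma tsum_scal c f P : tsum (fun b => c * f b) P = c * tsum f P.
Proof. induction P; [unfold tsum; simpl; lra|]. rewrite !tsum_cons, IHP. lra. Qed.

Lemma tsum_zero P : tsum (fun _ => 0) P = 0.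
Proof. induction P; [reflexivity|]. rewrite tsum_cons, IHP. lra. Qed.

Lemma tsum_pscale f c P : tsum f (pscale c P) = c * tsum f P.
Proof.
  induction P; [unfold tsum; simpl; lra|]. simpl pscale. rewrite !tsum_cons, IHP. simpl. lra.
Qed.

Lemma tsum_padd f P Q : tsum f (padd P Q) = tsum f P + tsum f Q.
Proof. apply tsum_app. Qed.

Lemma tsum_psub f P Q : tsum f (psub P Q) = tsum f P - tsum f Q.
Proof. unfold psub. rewrite tsum_padd, tsum_pscale. lra. Qed.

Definition madd (a b : mono) : mono := fun i => (a i + b i)%nat.

Lemma tsum_pmul f P Q : tsum f (pmul P Q) = tsum (fun b => tsum (fun b' => f (madd b b')) Q) P.
Proof.
  induction P as [|t P IH]; [reflexivity|].
  unfold pmul in *. simpl flat_map. rewrite tsum_app, IH, tsum_cons. f_equal.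
  clear IH. induction Q as [|u Q IHQ]; [unfold tsum; simpl; lra|].
  simpl map. rewrite !tsum_cons, IHQ. simpl fst; simpl snd. unfold madd. rewrite Rmult_plus_distr_l, Rmult_assoc. reflexivity.
Qed.

Lemma tsum_flat_map {A} f (g : A -> mpoly) l :
  tsum f (flat_map g l) = fold_right Rplus 0 (map (fun x => tsum f (g x)) l).
Proof. induction l; [reflexivity|]. simpl. rewrite tsum_app, IHl. reflexivity. Qed.

Lemma tsum_psum f k F : tsum f (psum k F) = rsum k (fun i => tsum f (F i)).
Proof. unfold psum, rsum. apply tsum_flat_map. Qed.

Lemma coef_tsum k P a : coef k P a = tsum (mon_ind k a) P.
Proof.
  induction P as [|t P IH]; [reflexivity|].
  unfold coef in *. rewrite tsum_cons, <- IH. unfold mon_ind. simpl.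
  destruct (mon_eqb k (snd t) a); simpl; lra.
Qed.

Lemma tsum_filter f h P : tsum f P = tsum f (filter h P) + tsum f (filter (fun t => negb (h t)) P).
Proof.
  induction P as [|t P IH]; [unfold tsum; simpl; lra|]. simpl.
  destruct (h t); simpl; rewrite !tsum_cons, IH; lra.
Qed.

Lemma tsum_filter_mon_eq k f P (t : R * mono) : respects k f ->
  tsum f (filter (fun u => mon_eqb k (snd u) (snd t)) P) = coef k P (snd t) * f (snd t).
Proof.
  intros Hf. induction P as [|u P IH]; [unfold tsum, coef; simpl; lra|].
  rewrite coef_tsum in *. simpl filter. rewrite tsum_cons. unfold mon_ind at 1.
  destruct (mon_eqb k (snd u) (snd t)) eqn:E.
  - rewrite tsum_cons, IH. apply mon_eqb_spec in E. rewrite (Hf _ _ E). lra.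
  - rewrite IH. lra.
Qed.

(* Grouping the terms of P by monomial shows that tsum f P only depends on the coefficients of P. *)
Lemma tsum_coef_decomp k P : exists reps : list mono,
  (forall a, In a reps -> exists u, In u P /\ meq k a (snd u)) /\
  (forall f, respects k f -> tsum f P = lsum (fun a => coef k P a * f a) reps).
Proof.
  remember (length P) as n eqn:Hn. revert P Hn.
  induction n as [n IHn] using lt_wf_ind. intros P Hn.
  destruct P as [|t P'].
  - exists []. split; [simpl; tauto|]. intros; reflexivity.
  - set (P := t :: P') in *.
    set (rest := filter (fun u => negb (mon_eqb k (snd u) (snd t))) P).
    assert (Hlen : (length rest < n)%nat).
    { subst n. unfold rest, P. simpl. rewrite mon_eqb_refl. simpl.
      pose proof (filter_length_le (fun u => negb (mon_eqb k (snd u) (snd t))) P'). lia. }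
    destruct (IHn _ Hlen rest eq_refl) as [R' [HR1 HR2]].
    exists (snd t :: R'). split.
    + intros a [<-|Ha]. * exists t. split; [left; auto| apply meq_refl].
      * destruct (HR1 a Ha) as [u [Hu1 Hu2]]. exists u. split; auto.
        unfold rest in Hu1. apply filter_In in Hu1. tauto.
    + intros f Hf. rewrite (tsum_filter f (fun u => mon_eqb k (snd u) (snd t)) P).
      rewrite tsum_filter_mon_eq by auto. fold rest. rewrite HR2 by auto.
      unfold lsum. simpl. f_equal. f_equal. apply map_ext_in. intros a Ha.
      f_equal. rewrite !coef_tsum.
      rewrite (tsum_filter (mon_ind k a) (fun u => mon_eqb k (snd u) (snd t)) P). fold rest.
      assert (HZ : tsum (mon_ind k a) (filter (fun u => mon_eqb k (snd u) (snd t)) P) = 0).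
      2:{ rewrite HZ. lra. }
      rewrite (tsum_ext_in (mon_ind k a) (fun _ => 0)). { apply tsum_zero. }
      intros u Hu. apply filter_In in Hu. destruct Hu as [_ Hu].
      apply mon_eqb_spec in Hu. unfold mon_ind.
      destruct (mon_eqb k (snd u) a) eqn:E; auto. apply mon_eqb_spec in E.
      exfalso. destruct (HR1 a Ha) as [v [Hv1 Hv2]].
      unfold rest in Hv1. apply filter_In in Hv1. destruct Hv1 as [_ Hv1].
      assert (meq k (snd v) (snd t)).
      { eapply meq_trans; [apply meq_sym; eauto|]. eapply meq_trans; [apply meq_sym; eauto|]. auto. }
      apply mon_eqb_spec in H. rewrite H in Hv1. discriminate.
Qed.

Lemma coef_app k P Q a : coef k (P ++ Q) a = coef k P a + coef k Q a.
Proof. rewrite !coef_tsum. apply tsum_app. Qed.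

Lemma coef_pscale k c P a : coef k (pscale c P) a = c * coef k P a.
Proof. rewrite !coef_tsum. apply tsum_pscale. Qed.

Lemma tsum_nonneg k f P : respects k f -> (forall a, 0 <= coef k P a) -> (forall b, 0 <= f b) -> 0 <= tsum f P.
Proof.
  intros Hf H1 H2. destruct (tsum_coef_decomp k P) as [r [_ Hr]]. rewrite Hr by auto.
  apply lsum_nonneg. intros a _. apply Rmult_le_pos; auto.
Qed.

Definition respectsb (k : nat) (q : mono -> bool) : Prop := forall a b, meq k a b -> q a = q b.

Lemma tsum_supp k f q P : respects k f -> respectsb k q -> (forall a, q a = false -> coef k P a = 0) ->
  tsum f P = tsum (fun b => if q b then f b else 0) P.
Proof.
  intros Hf Hq H. destruct (tsum_coef_decomp k P) as [r [_ Hr]]. rewrite !Hr; auto.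
  - apply lsum_ext. intros a _. destruct (q a) eqn:E; auto. rewrite H; auto. lra.
  - intros a b Hab. rewrite (Hq a b Hab). destruct (q b); auto.
Qed.

Lemma coef_meq k P a b : meq k a b -> coef k P a = coef k P b.
Proof.
  intros H. rewrite !coef_tsum. apply tsum_ext. intros c. unfold mon_ind.
  destruct (mon_eqb k c a) eqn:E1, (mon_eqb k c b) eqn:E2; auto; exfalso.
  - apply mon_eqb_spec in E1. assert (meq k c b) by (eapply meq_trans; eauto).
    apply mon_eqb_spec in H0; congruence.
  - apply mon_eqb_spec in E2. assert (meq k c a) by (eapply meq_trans; eauto; apply meq_sym; auto).
    apply mon_eqb_spec in H0; congruence.
Qed.

Lemma coef_support k P a : coef k P a <> 0 -> exists u, In u P /\ meq k (snd u) a.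
Proof.
  intros H. apply NNPP. intros Hn. apply H. rewrite coef_tsum.
  rewrite (tsum_ext_in _ (fun _ => 0)). apply tsum_zero.
  intros t Ht. unfold mon_ind. destruct (mon_eqb k (snd t) a) eqn:E; auto.
  exfalso. apply Hn. exists t. split; auto. apply mon_eqb_spec; auto.
Qed.

Lemma mdeg_meq k a b : meq k a b -> mdeg k a = mdeg k b.
Proof.
  intros H. unfold mdeg. f_equal. apply map_ext_in. intros i Hi. apply in_seq in Hi. apply H. lia.
Qed.

Lemma mdeg_madd k a b : mdeg k (madd a b) = (mdeg k a + mdeg k b)%nat.
Proof. unfold mdeg, madd. apply fold_add_map_add. Qed.

Lemma mdeg_zero k : mdeg k (fun _ => 0%nat) = 0%nat.
Proof. unfold mdeg. induction (seq 0 k); simpl; lia. Qed.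

Definition evec (i : nat) : mono := fun j => if Nat.eqb j i then 1%nat else 0%nat.

Lemma mdeg_evec k i : (i < k)%nat -> mdeg k (evec i) = 1%nat.
Proof.
  intros H. unfold mdeg, evec. rewrite fold_ind_v by apply seq_NoDup.
  destruct (existsb (Nat.eqb i) (seq 0 k)) eqn:E; auto.
  exfalso. assert (existsb (Nat.eqb i) (seq 0 k) = true); [|congruence].
  apply existsb_exists. exists i. split; [apply in_seq; lia| apply Nat.eqb_refl].
Qed.

Definition is_homog (k D : nat) (P : mpoly) : Prop := forall a, mdeg k a <> D -> coef k P a = 0.

Lemma is_homog_tsum k D P f : is_homog k D P -> respects k f ->
  tsum f P = tsum (fun b => if Nat.eqb (mdeg k b) D then f b else 0) P.
Proof.
  intros H Hf. apply tsum_supp with (k := k); auto.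
  - intros a b Hab. rewrite (mdeg_meq k a b Hab). auto.
  - intros a Ha. apply H. apply Nat.eqb_neq; auto.
Qed.

Lemma is_homog_eq k D D' P : D = D' -> is_homog k D P -> is_homog k D' P.
Proof. intros ->; auto. Qed.

Lemma is_homog_app k D P Q : is_homog k D P -> is_homog k D Q -> is_homog k D (P ++ Q).
Proof. intros H1 H2 a Ha. rewrite coef_app, H1, H2 by auto. lra. Qed.

Lemma is_homog_pscale k D c P : is_homog k D P -> is_homog k D (pscale c P).
Proof. intros H a Ha. rewrite coef_pscale, H by auto. lra. Qed.

Lemma is_homog_padd k D P Q : is_homog k D P -> is_homog k D Q -> is_homog k D (padd P Q).
Proof. apply is_homog_app. Qed.

Lemma is_homog_psub k D P Q : is_homog k D P -> is_homog k D Q -> is_homog k D (psub P Q).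
Proof. intros; apply is_homog_padd; auto; apply is_homog_pscale; auto. Qed.

Lemma is_homog_pconst k c : is_homog k 0 (pconst c).
Proof.
  intros a Ha. unfold coef, pconst. simpl.
  destruct (mon_eqb k (fun _ => 0%nat) a) eqn:E; simpl; [|lra].
  apply mon_eqb_spec in E. apply mdeg_meq in E. rewrite mdeg_zero in E. lia.
Qed.

Lemma is_homog_pvar k i : (i < k)%nat -> is_homog k 1 (pvar i).
Proof.
  intros Hi a Ha. unfold coef, pvar. simpl.
  destruct (mon_eqb k _ a) eqn:E; simpl; [|lra].
  apply mon_eqb_spec in E. apply mdeg_meq in E. fold (evec i) in E. rewrite mdeg_evec in E; lia.
Qed.

Lemma meq_madd_l k a b c : meq k a b -> meq k (madd a c) (madd b c).
Proof. intros H i Hi. unfold madd. rewrite H; auto. Qed.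

Lemma meq_madd_r k a b c : meq k a b -> meq k (madd c a) (madd c b).
Proof. intros H i Hi. unfold madd. rewrite H; auto. Qed.

Lemma coef_pmul k P Q a :
  coef k (pmul P Q) a = tsum (fun b => tsum (fun b' => mon_ind k a (madd b b')) Q) P.
Proof. rewrite coef_tsum. apply tsum_pmul. Qed.

Lemma is_homog_pmul k D1 D2 P Q : is_homog k D1 P -> is_homog k D2 Q -> is_homog k (D1 + D2) (pmul P Q).
Proof.
  intros H1 H2 a Ha. rewrite coef_pmul.
  rewrite (is_homog_tsum k D1 P); auto.
  2:{ intros b c Hbc. apply tsum_ext. intros b'. apply respects_mon_ind. apply meq_madd_l; auto. }
  rewrite (tsum_ext _ (fun _ => 0)). apply tsum_zero. intros b.
  destruct (Nat.eqb (mdeg k b) D1) eqn:E; auto. apply Nat.eqb_eq in E.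
  rewrite (is_homog_tsum k D2 Q); auto.
  2:{ intros c c' Hc. apply respects_mon_ind. apply meq_madd_r; auto. }
  rewrite (tsum_ext _ (fun _ => 0)). apply tsum_zero. intros b'.
  destruct (Nat.eqb (mdeg k b') D2) eqn:E2; auto. apply Nat.eqb_eq in E2.
  unfold mon_ind. destruct (mon_eqb k (madd b b') a) eqn:E3; auto.
  apply mon_eqb_spec, mdeg_meq in E3. rewrite mdeg_madd in E3. lia.
Qed.

Lemma is_homog_ppow k D P e : is_homog k D P -> is_homog k (e * D) (ppow P e).
Proof.
  intros H. induction e; simpl.
  - apply is_homog_pconst.
  - apply is_homog_pmul; auto.
Qed.

Lemma is_homog_pvarpow k i e : (i < k)%nat -> is_homog k e (ppow (pvar i) e).
Proof. intros Hi. apply (is_homog_eq k (e * 1)); [lia|]. apply is_homog_ppow, is_homog_pvar; auto. Qed.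

Lemma coef_psum k n F a : coef k (psum n F) a = rsum n (fun i => coef k (F i) a).
Proof. rewrite coef_tsum, tsum_psum. unfold rsum. f_equal. apply map_ext. intros; rewrite coef_tsum; auto. Qed.

Lemma is_homog_psum k D n F : (forall i, (i < n)%nat -> is_homog k D (F i)) -> is_homog k D (psum n F).
Proof.
  intros H a Ha. rewrite coef_psum, (rsum_ext_in n _ (fun _ => 0)), rsum_const; [ring|].
  intros i Hi. apply H; auto.
Qed.

Definition subst_mono (k : nat) (q : nat -> mpoly) (b : mono) : mpoly :=
  fold_right pmul (pconst 1) (map (fun i => ppow (q i) (b i)) (seq 0 k)).

Lemma coef_psubst K k P q a :
  coef K (psubst k P q) a = tsum (fun b => coef K (subst_mono k q b) a) P.
Proof.
  rewrite coef_tsum. unfold psubst. rewrite tsum_flat_map. unfold tsum at 2.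
  f_equal. apply map_ext. intros t. rewrite tsum_pscale, coef_tsum. reflexivity.
Qed.

Lemma subst_mono_meq k q b c : meq k b c -> subst_mono k q b = subst_mono k q c.
Proof.
  intros H. unfold subst_mono. f_equal. apply map_ext_in. intros i Hi. apply in_seq in Hi. rewrite H; auto. lia.
Qed.

Lemma is_homog_subst_mono K k e q b : (forall i, (i < k)%nat -> is_homog K e (q i)) -> is_homog K (e * mdeg k b) (subst_mono k q b).
Proof.
  intros H. unfold subst_mono, mdeg. assert (Hl : forall i, In i (seq 0 k) -> (i < k)%nat).
  { intros i Hi; apply in_seq in Hi; lia. }
  induction (seq 0 k) as [|i l IH]; simpl.
  - rewrite Nat.mul_0_r. apply is_homog_pconst.
  - rewrite Nat.mul_add_distr_l. apply is_homog_pmul.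
    + rewrite Nat.mul_comm. apply is_homog_ppow. apply H, Hl; left; auto.
    + apply IH. intros; apply Hl; right; auto.
Qed.

Lemma is_homog_psubst K k e D P q : is_homog k D P -> (forall i, (i < k)%nat -> is_homog K e (q i)) ->
  is_homog K (e * D) (psubst k P q).
Proof.
  intros HP Hq a Ha. rewrite coef_psubst. rewrite (is_homog_tsum k D P); auto.
  2:{ intros b c H. rewrite (subst_mono_meq k q b c H). auto. }
  rewrite (tsum_ext _ (fun _ => 0)). apply tsum_zero. intros b.
  destruct (Nat.eqb (mdeg k b) D) eqn:E; auto. apply Nat.eqb_eq in E.
  apply (is_homog_subst_mono K k e q b Hq). rewrite E. auto.
Qed.

Definition homog_mono (n yi D : nat) (b : mono) : mono :=
  fun i => if Nat.ltb i n then b i else if Nat.eqb i yi then (D - mdeg n b)%nat else 0%nat.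

Lemma tsum_homog f n yi D P : tsum f (homog n yi D P) = tsum (fun b => f (homog_mono n yi D b)) P.
Proof. induction P; [reflexivity|]. simpl homog. rewrite !tsum_cons, IHP. reflexivity. Qed.

Lemma pdeg_bound k P a : coef k P a <> 0 -> (mdeg k a <= pdeg k P)%nat.
Proof.
  intros H. destruct (coef_support k P a H) as [u [Hu Hm]].
  unfold pdeg. eapply Nat.le_trans; [|apply fold_max_ge_in; apply in_map; exact Hu].
  simpl. destruct (Req_EM_T (coef k P (snd u)) 0) as [E|E].
  - exfalso. rewrite (coef_meq k P _ _ Hm) in E. auto.
  - rewrite (mdeg_meq k _ _ Hm). lia.
Qed.

Lemma mdeg_homog_mono n yi D N b : (n <= yi)%nat -> (yi < N)%nat -> (mdeg n b <= D)%nat ->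
  mdeg N (homog_mono n yi D b) = D.
Proof.
  intros H1 H2 H3. unfold mdeg. replace N with (n + (N - n))%nat by lia.
  rewrite seq_app, map_app, fold_right_app.
  rewrite (map_ext_in (homog_mono n yi D b) (fun i => if Nat.eqb i yi then (D - mdeg n b)%nat else 0%nat) (seq (0 + n) (N - n))).
  2:{ intros i Hi. apply in_seq in Hi. unfold homog_mono. destruct (Nat.ltb i n) eqn:E; auto. apply Nat.ltb_lt in E. lia. }
  rewrite fold_ind_v by apply seq_NoDup.
  destruct (existsb (Nat.eqb yi) (seq (0 + n) (N - n))) eqn:E.
  2:{ exfalso. assert (existsb (Nat.eqb yi) (seq (0 + n) (N - n)) = true); [|congruence].
      apply existsb_exists. exists yi. split; [apply in_seq; lia| apply Nat.eqb_refl]. }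
  assert (Hfirst : forall a, fold_right Nat.add a (map (homog_mono n yi D b) (seq 0 n)) =
     (fold_right Nat.add 0%nat (map b (seq 0 n)) + a)%nat).
  { intros a. assert (Hs : forall i, In i (seq 0 n) -> homog_mono n yi D b i = b i).
    { intros i Hi. apply in_seq in Hi. unfold homog_mono. destruct (Nat.ltb i n) eqn:E'; auto. apply Nat.ltb_ge in E'. lia. }
    induction (seq 0 n) as [|x l IH]; simpl; auto.
    rewrite Hs by (left; auto). rewrite IH. lia. intros; apply Hs; right; auto. }
  rewrite Hfirst. change (fold_right Nat.add 0%nat (map b (seq 0 n))) with (mdeg n b). lia.
Qed.

Lemma is_homog_homog n yi D N P : (n <= yi)%nat -> (yi < N)%nat ->
  (forall a, coef n P a <> 0 -> (mdeg n a <= D)%nat) -> is_homog N D (homog n yi D P).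
Proof.
  intros H1 H2 H3 a Ha. rewrite coef_tsum, tsum_homog.
  assert (Hresp : respects n (fun b => mon_ind N a (homog_mono n yi D b))).
  { intros b c Hbc. apply respects_mon_ind. intros i Hi. unfold homog_mono.
    destruct (Nat.ltb i n) eqn:E. apply Nat.ltb_lt in E. auto.
    rewrite (mdeg_meq n b c Hbc). auto. }
  rewrite (tsum_supp n _ (fun b => Nat.leb (mdeg n b) D)); auto.
  - rewrite (tsum_ext _ (fun _ => 0)). apply tsum_zero. intros b.
    destruct (Nat.leb (mdeg n b) D) eqn:E; auto. apply Nat.leb_le in E.
    unfold mon_ind. destruct (mon_eqb N (homog_mono n yi D b) a) eqn:E2; auto.
    apply mon_eqb_spec, mdeg_meq in E2. rewrite mdeg_homog_mono in E2; auto. lia.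
  - intros b c Hbc. rewrite (mdeg_meq n b c Hbc). auto.
  - intros b Hb. destruct (Req_dec (coef n P b) 0); auto. apply H3 in H. apply Nat.leb_gt in Hb. lia.
Qed.

Definition even_exps (k : nat) (P : mpoly) : Prop :=
  forall t, In t P -> forall i, (i < k)%nat -> Nat.Even (snd t i).

Lemma even_exps_app k P Q : even_exps k P -> even_exps k Q -> even_exps k (P ++ Q).
Proof. intros H1 H2 t Ht. apply in_app_or in Ht. destruct Ht; auto. Qed.

Lemma even_exps_pscale k c P : even_exps k P -> even_exps k (pscale c P).
Proof. intros H t Ht. unfold pscale in Ht. apply in_map_iff in Ht. destruct Ht as [u [<- Hu]]. simpl. apply H; auto. Qed.

Lemma even_exps_padd k P Q : even_exps k P -> even_exps k Q -> even_exps k (padd P Q).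
Proof. apply even_exps_app. Qed.

Lemma even_exps_psub k P Q : even_exps k P -> even_exps k Q -> even_exps k (psub P Q).
Proof. intros; apply even_exps_padd; auto; apply even_exps_pscale; auto. Qed.

Lemma even_exps_pconst k c : even_exps k (pconst c).
Proof. intros t [<-|[]] i _. exists 0%nat. reflexivity. Qed.

Lemma even_exps_pmul k P Q : even_exps k P -> even_exps k Q -> even_exps k (pmul P Q).
Proof.
  intros H1 H2 t Ht i Hi. unfold pmul in Ht. apply in_flat_map in Ht. destruct Ht as [u [Hu Ht]].
  apply in_map_iff in Ht. destruct Ht as [v [<- Hv]]. simpl.
  destruct (H1 u Hu i Hi) as [x Hx]. destruct (H2 v Hv i Hi) as [y Hy]. exists (x + y)%nat. unfold mono in *. rewrite Hx, Hy. lia.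
Qed.

Lemma even_exps_ppow k P e : even_exps k P -> even_exps k (ppow P e).
Proof. intros H. induction e; simpl; [apply even_exps_pconst| apply even_exps_pmul; auto]. Qed.

Lemma even_exps_psum k n F : (forall i, even_exps k (F i)) -> even_exps k (psum n F).
Proof. intros H t Ht. unfold psum in Ht. apply in_flat_map in Ht. destruct Ht as [i [_ Ht]]. apply (H i); auto. Qed.

Lemma even_exps_psubst K k P q : (forall i, even_exps K (q i)) -> even_exps K (psubst k P q).
Proof.
  intros H t Ht. unfold psubst in Ht. apply in_flat_map in Ht. destruct Ht as [u [_ Ht]].
  revert t Ht. apply even_exps_pscale. induction (seq 0 k); simpl; [apply even_exps_pconst|].
  apply even_exps_pmul; auto. apply even_exps_ppow; auto.
Qed.

Lemma even_exps_pvar2 k i : even_exps k (ppow (pvar i) 2).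
Proof.
  intros t Ht j _. simpl in Ht. destruct Ht as [<-|[]]. simpl. exists (if Nat.eqb j i then 1 else 0)%nat.
  destruct (Nat.eqb j i); lia.
Qed.

Lemma even_exps_pvar4 k i : even_exps k (ppow (pvar i) 4).
Proof.
  intros t Ht j _. simpl in Ht. destruct Ht as [<-|[]]. simpl. exists (2 * (if Nat.eqb j i then 1 else 0))%nat.
  destruct (Nat.eqb j i); lia.
Qed.

Definition mon_eval (k : nat) (x : nat -> R) (b : mono) : R := rprod k (fun i => x i ^ b i).

Lemma peval_tsum k P x : peval k P x = tsum (mon_eval k x) P.
Proof. reflexivity. Qed.

Lemma mon_eval_madd k x a b : mon_eval k x (madd a b) = mon_eval k x a * mon_eval k x b.
Proof.
  unfold mon_eval, rprod, madd. fold (lprod (seq 0 k) (fun i => x i ^ (a i + b i))).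
  fold (lprod (seq 0 k) (fun i => x i ^ a i)). fold (lprod (seq 0 k) (fun i => x i ^ b i)).
  rewrite <- lprod_mul. apply lprod_ext_in. intros; apply pow_add.
Qed.

Lemma mon_eval_respects k x : respects k (mon_eval k x).
Proof.
  intros a b H. unfold mon_eval, rprod. f_equal. apply map_ext_in. intros i Hi. apply in_seq in Hi. rewrite H; auto. lia.
Qed.

Lemma mon_eval_nonneg k x b : (forall i, 0 <= x i) -> 0 <= mon_eval k x b.
Proof. intros H. unfold mon_eval, rprod. induction (seq 0 k); simpl; [lra|]. apply Rmult_le_pos; auto. apply pow_le; auto. Qed.

Lemma mon_eval_zero k x : mon_eval k x (fun _ => 0%nat) = 1.
Proof. unfold mon_eval, rprod. fold (lprod (seq 0 k) (fun i => x i ^ 0)). simpl. apply lprod_one. Qed.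

Lemma mon_eval_evec k x i : (i < k)%nat -> mon_eval k x (evec i) = x i.
Proof.
  intros Hi. unfold mon_eval, rprod. fold (lprod (seq 0 k) (fun j => x j ^ evec i j)).
  rewrite (lprod_ext_in _ _ (fun j => if Nat.eqb j i then x i else 1)).
  2:{ intros j _. unfold evec. destruct (Nat.eqb j i) eqn:E; simpl; [apply Nat.eqb_eq in E; subst|]; ring. }
  rewrite lprod_evec by apply seq_NoDup.
  destruct (existsb (Nat.eqb i) (seq 0 k)) eqn:E; auto.
  exfalso. assert (existsb (Nat.eqb i) (seq 0 k) = true); [|congruence].
  apply existsb_exists. exists i. split; [apply in_seq; lia| apply Nat.eqb_refl].
Qed.

Lemma mon_eval_scale k lam z b : mon_eval k (fun i => lam * z i) b = lam ^ mdeg k b * mon_eval k z b.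
Proof.
  unfold mon_eval, rprod, mdeg. induction (seq 0 k); simpl; [ring|].
  rewrite IHl, pow_add, Rpow_mult_distr. ring.
Qed.

Lemma peval_pmul k P Q x : peval k (pmul P Q) x = peval k P x * peval k Q x.
Proof.
  rewrite !peval_tsum, tsum_pmul.
  transitivity (tsum (fun b => peval k Q x * mon_eval k x b) P).
  - apply tsum_ext. intros b.
    rewrite (tsum_ext _ (fun b' => mon_eval k x b * mon_eval k x b')) by (intros; apply mon_eval_madd).
    rewrite tsum_scal, peval_tsum. ring.
  - rewrite tsum_scal, peval_tsum. ring.
Qed.

Lemma peval_padd k P Q x : peval k (padd P Q) x = peval k P x + peval k Q x.
Proof. rewrite !peval_tsum. apply tsum_padd. Qed.

Lemma peval_pscale k c P x : peval k (pscale c P) x = c * peval k P x.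
Proof. rewrite !peval_tsum. apply tsum_pscale. Qed.

Lemma peval_psub k P Q x : peval k (psub P Q) x = peval k P x - peval k Q x.
Proof. rewrite !peval_tsum. apply tsum_psub. Qed.

Lemma peval_psum k n F x : peval k (psum n F) x = rsum n (fun i => peval k (F i) x).
Proof. rewrite !peval_tsum. apply tsum_psum. Qed.

Lemma peval_pconst k c x : peval k (pconst c) x = c.
Proof. rewrite peval_tsum. unfold pconst. rewrite tsum_cons, tsum_nil. simpl. rewrite mon_eval_zero. ring. Qed.

Lemma peval_ppow k P e x : peval k (ppow P e) x = peval k P x ^ e.
Proof. induction e; simpl; [apply peval_pconst|]. rewrite peval_pmul, IHe. ring. Qed.

Lemma peval_pvar k i x : (i < k)%nat -> peval k (pvar i) x = x i.
Proof. intros Hi. rewrite peval_tsum. unfold pvar. rewrite tsum_cons, tsum_nil. simpl. fold (evec i). rewrite mon_eval_evec; auto. ring. Qed.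

Lemma peval_pvar_pow k i e x : (i < k)%nat -> peval k (ppow (pvar i) e) x = x i ^ e.
Proof. intros; rewrite peval_ppow, peval_pvar; auto. Qed.

Lemma peval_ext k P x y : (forall i, (i < k)%nat -> x i = y i) -> peval k P x = peval k P y.
Proof.
  intros H. rewrite !peval_tsum. apply tsum_ext. intros b. unfold mon_eval, rprod. f_equal. apply map_ext_in.
  intros i Hi. apply in_seq in Hi. rewrite H; auto. lia.
Qed.

Lemma peval_fold_pmul_ppow K q (b : mono) l x :
  peval K (fold_right pmul (pconst 1) (map (fun i => ppow (q i) (b i)) l)) x
  = fold_right Rmult 1 (map (fun i => peval K (q i) x ^ b i) l).
Proof.
  induction l; simpl; [apply peval_pconst|]. rewrite peval_pmul, peval_ppow, IHl. reflexivity.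
Qed.

Lemma peval_psubst K k P q x : peval K (psubst k P q) x = peval k P (fun i => peval K (q i) x).
Proof.
  rewrite peval_tsum. unfold psubst. rewrite tsum_flat_map. rewrite peval_tsum. unfold tsum at 2.
  f_equal. apply map_ext. intros t. rewrite tsum_pscale. f_equal.
  rewrite <- peval_tsum. rewrite peval_fold_pmul_ppow. reflexivity.
Qed.

Lemma mon_eval_homog_mono n yi D N z b : (n <= yi)%nat -> (yi < N)%nat ->
  mon_eval N z (homog_mono n yi D b) = mon_eval n z b * z yi ^ (D - mdeg n b).
Proof.
  intros H1 H2. unfold mon_eval, rprod. replace N with (n + (N - n))%nat by lia.
  rewrite seq_app. fold (lprod (seq 0 n ++ seq (0 + n) (N - n)) (fun i => z i ^ homog_mono n yi D b i)).
  rewrite lprod_app. fold (lprod (seq 0 n) (fun i => z i ^ b i)). f_equal.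
  - apply lprod_ext_in. intros i Hi. apply in_seq in Hi. unfold homog_mono.
    destruct (Nat.ltb i n) eqn:E; auto. apply Nat.ltb_ge in E. lia.
  - rewrite (lprod_ext_in _ _ (fun j => if Nat.eqb j yi then z yi ^ (D - mdeg n b) else 1)).
    2:{ intros i Hi. apply in_seq in Hi. unfold homog_mono. destruct (Nat.ltb i n) eqn:E.
        apply Nat.ltb_lt in E. lia. destruct (Nat.eqb i yi) eqn:E2; [apply Nat.eqb_eq in E2; subst|]; simpl; ring. }
    rewrite lprod_evec by apply seq_NoDup.
    destruct (existsb (Nat.eqb yi) (seq (0 + n) (N - n))) eqn:E; auto.
    exfalso. assert (existsb (Nat.eqb yi) (seq (0 + n) (N - n)) = true); [|congruence].
    apply existsb_exists. exists yi. split; [apply in_seq; lia| apply Nat.eqb_refl].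
Qed.

Lemma peval_homog n yi D N P z : (n <= yi)%nat -> (yi < N)%nat ->
  peval N (homog n yi D P) z = tsum (fun b => mon_eval n z b * z yi ^ (D - mdeg n b)) P.
Proof.
  intros H1 H2. rewrite peval_tsum, tsum_homog. apply tsum_ext. intros b. apply mon_eval_homog_mono; auto.
Qed.

Lemma peval_homog_1 n yi D N P z : (n <= yi)%nat -> (yi < N)%nat -> z yi = 1 ->
  peval N (homog n yi D P) z = peval n P z.
Proof.
  intros H1 H2 H3. rewrite peval_homog by auto. rewrite peval_tsum. apply tsum_ext. intros b.
  rewrite H3, pow1. ring.
Qed.

Lemma mon_eval_div n z y b : y <> 0 -> mon_eval n (fun i => z i / y) b = mon_eval n z b * (/ y) ^ mdeg n b.
Proof.
  intros Hy. unfold mon_eval, rprod, mdeg. induction (seq 0 n); simpl; [ring|].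
  rewrite IHl, pow_add. unfold Rdiv. rewrite Rpow_mult_distr. ring.
Qed.

Lemma peval_homog_y n yi D N P z : (n <= yi)%nat -> (yi < N)%nat -> z yi <> 0 ->
  (forall a, coef n P a <> 0 -> (mdeg n a <= D)%nat) ->
  peval N (homog n yi D P) z = z yi ^ D * peval n P (fun i => z i / z yi).
Proof.
  intros H1 H2 H3 H4. rewrite peval_homog by auto. rewrite peval_tsum.
  set (q := fun b => Nat.leb (mdeg n b) D).
  assert (Hq : respectsb n q). { intros a b Hab. unfold q. rewrite (mdeg_meq n a b Hab). auto. }
  assert (Hs : forall a, q a = false -> coef n P a = 0).
  { intros a Ha. destruct (Req_dec (coef n P a) 0); auto. apply H4 in H. unfold q in Ha. apply Nat.leb_gt in Ha. lia. }
  rewrite (tsum_supp n _ q P); auto.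
  2:{ intros a b Hab. rewrite (mon_eval_respects n z a b Hab), (mdeg_meq n a b Hab). auto. }
  rewrite (tsum_supp n (mon_eval n (fun i => z i / z yi)) q P); auto. 2: apply mon_eval_respects.
  rewrite <- tsum_scal. apply tsum_ext. intros b. unfold q. destruct (Nat.leb (mdeg n b) D) eqn:E; [|ring].
  apply Nat.leb_le in E. rewrite mon_eval_div by auto.
  replace D with (mdeg n b + (D - mdeg n b))%nat at 2 by lia. rewrite pow_add.
  rewrite pow_inv by auto. field. apply pow_nonzero; auto.
Qed.

Lemma peval_scale k D P lam z : is_homog k D P ->
  peval k P (fun i => lam * z i) = lam ^ D * peval k P z.
Proof.
  intros H. rewrite !peval_tsum. rewrite (is_homog_tsum k D P); auto. 2: apply mon_eval_respects.
  rewrite (is_homog_tsum k D P (mon_eval k z)); auto. 2: apply mon_eval_respects.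
  rewrite <- tsum_scal. apply tsum_ext. intros b. destruct (Nat.eqb (mdeg k b) D) eqn:E; [|ring].
  apply Nat.eqb_eq in E. rewrite mon_eval_scale, E. ring.
Qed.

Lemma peval_nonneg_of_nonneg_coefs k P x :
  has_nonneg_coefs k P -> (forall i, 0 <= x i) -> 0 <= peval k P x.
Proof.
  intros HP Hx. rewrite peval_tsum.
  apply (tsum_nonneg k); [apply mon_eval_respects| exact HP| intros; apply mon_eval_nonneg; auto].
Qed.

(** * The form h *)

Lemma dd_ge1 n m p g : (1 <= dd n m p g)%nat.
Proof. unfold dd. lia. Qed.

Lemma dd_max n m p g : (maxdeg n m p g <= 2 * dd n m p g)%nat.
Proof.
  unfold dd. set (M := maxdeg n m p g).
  pose proof (Nat.div_mod (M + 1) 2 ltac:(lia)). pose proof (Nat.mod_upper_bound (M+1) 2 ltac:(lia)).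
  lia.
Qed.

Lemma mdeg_p_le n m p g a : coef n p a <> 0 -> (mdeg n a <= 2 * dd n m p g)%nat.
Proof.
  intros H. apply pdeg_bound in H. pose proof (dd_max n m p g).
  assert (pdeg n p <= maxdeg n m p g)%nat by apply fold_max_ge0. lia.
Qed.

Lemma mdeg_g_le n m p g j a : (j < m)%nat -> coef n (g j) a <> 0 -> (mdeg n a <= 2 * dd n m p g)%nat.
Proof.
  intros Hj H. apply pdeg_bound in H. pose proof (dd_max n m p g).
  assert (pdeg n (g j) <= maxdeg n m p g)%nat.
  { apply fold_max_ge_in. apply (in_map (fun j => pdeg n (g j))). apply in_seq. lia. } lia.
Qed.

Definition hbound (m : nat) (Rb : R) (eta : nat -> R) (beta : R) : R := Rb + rsum m eta + beta.

Lemma peval_hform n m p g Rb eta beta z :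
  let d := dd n m p g in let yi := (n + m + 2)%nat in let N := (n + m + 3)%nat in
  peval N (hform n m p g Rb eta beta) z =
    (peval N (homog n yi (2 * d) p) z + z n ^ 2 * z yi ^ (2 * d - 2)) ^ 2
  + rsum m (fun j => (peval N (homog n yi (2 * d) (g j)) z - z (n + S j)%nat ^ 2 * z yi ^ (2 * d - 2)) ^ 2)
  + (hbound m Rb eta beta ^ d * z yi ^ (2 * d)
     - (rsum n (fun i => z i ^ 2) + rsum (S m) (fun j => z (n + j)%nat ^ 2)) ^ d
     - z (n + S m)%nat ^ (2 * d)) ^ 2.
Proof.
  intros d yi N. unfold hform. fold d. fold yi.
  rewrite !peval_padd, peval_ppow, peval_padd, peval_pmul, !peval_pvar_pow by lia.
  rewrite peval_psum. rewrite (rsum_ext_in m _ (fun j => (peval N (homog n yi (2 * d) (g j)) z - z (n + S j)%nat ^ 2 * z yi ^ (2 * d - 2)) ^ 2)).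
  2:{ intros j Hj. rewrite peval_ppow, peval_psub, peval_pmul, !peval_pvar_pow by lia. reflexivity. }
  rewrite peval_ppow, !peval_psub, peval_pscale, !peval_ppow, peval_padd, !peval_psum, !peval_pvar by lia.
  rewrite (rsum_ext_in n _ (fun i => z i ^ 2)) by (intros; apply peval_pvar_pow; lia).
  rewrite (rsum_ext_in (S m) _ (fun j => z (n + j)%nat ^ 2)) by (intros; apply peval_pvar_pow; lia).
  unfold hbound. rewrite Nat.add_0_r. rewrite <- (Rplus_assoc (_ ^ 2)). reflexivity.
Qed.

Lemma is_homog_hform n m p g Rb eta beta :
  is_homog (n + m + 3) (4 * dd n m p g) (hform n m p g Rb eta beta).
Proof.
  pose proof (dd_ge1 n m p g) as Hd.
  unfold hform. set (d := dd n m p g) in *. set (N := (n + m + 3)%nat).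
  assert (HS : is_homog N (2 * d) (pmul (ppow (pvar (n + 0)) 2) (ppow (pvar (n + m + 2)) (2 * d - 2)))).
  { apply (is_homog_eq N (2 + (2 * d - 2))); [lia|]. apply is_homog_pmul; apply is_homog_pvarpow; unfold N; lia. }
  apply is_homog_padd; [|apply is_homog_padd].
  - apply (is_homog_eq N (2 * (2 * d))); [lia|]. apply is_homog_ppow. apply is_homog_padd; auto.
    apply is_homog_homog; try (unfold N; lia). intros a Ha. apply (mdeg_p_le n m p g a Ha).
  - apply is_homog_psum. intros j Hj.
    apply (is_homog_eq N (2 * (2 * d))); [lia|]. apply is_homog_ppow. apply is_homog_psub.
    + apply is_homog_homog; try (unfold N; lia). intros a Ha. apply (mdeg_g_le n m p g j a Hj Ha).
    + apply (is_homog_eq N (2 + (2 * d - 2))); [lia|]. apply is_homog_pmul; apply is_homog_pvarpow; unfold N; lia.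
  - apply (is_homog_eq N (2 * (2 * d))); [lia|]. apply is_homog_ppow. apply is_homog_psub; [apply is_homog_psub|].
    + apply is_homog_pscale. apply is_homog_pvarpow. unfold N; lia.
    + apply (is_homog_eq N (d * 2)); [lia|]. apply is_homog_ppow. apply is_homog_padd; apply is_homog_psum; intros i Hi;
      apply is_homog_pvarpow; unfold N; lia.
    + apply is_homog_pvarpow. unfold N; lia.
Qed.

Lemma hform_nonneg n m p g Rb eta beta z : 0 <= peval (n + m + 3) (hform n m p g Rb eta beta) z.
Proof.
  rewrite peval_hform.
  match goal with |- 0 <= ?A ^ 2 + ?B + ?C ^ 2 =>
    assert (0 <= B) by (apply rsum_nonneg; intros; apply pow2_ge_0);
    pose proof (pow2_ge_0 A); pose proof (pow2_ge_0 C)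
  end.
  lra.
Qed.

Lemma hform_eq_0 n m p g Rb eta beta z :
  let d := dd n m p g in let yi := (n + m + 2)%nat in let N := (n + m + 3)%nat in
  peval N (hform n m p g Rb eta beta) z = 0 ->
  peval N (homog n yi (2 * d) p) z = - z n ^ 2 * z yi ^ (2 * d - 2) /\
  (forall j, (j < m)%nat ->
     peval N (homog n yi (2 * d) (g j)) z = z (n + S j)%nat ^ 2 * z yi ^ (2 * d - 2)) /\
  hbound m Rb eta beta ^ d * z yi ^ (2 * d)
    = (rsum n (fun i => z i ^ 2) + rsum (S m) (fun j => z (n + j)%nat ^ 2)) ^ d + z (n + S m)%nat ^ (2 * d).
Proof.
  intros d yi N Hh. unfold N in Hh. rewrite peval_hform in Hh. fold d yi N in Hh.
  match type of Hh with ?A ^ 2 + ?B + ?C ^ 2 = 0 =>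
    assert (HB : 0 <= B) by (apply rsum_nonneg; intros; apply pow2_ge_0);
    pose proof (pow2_ge_0 A); pose proof (pow2_ge_0 C);
    assert (HA0 : A ^ 2 = 0) by lra; assert (HB0 : B = 0) by lra; assert (HC0 : C ^ 2 = 0) by lra
  end.
  apply pow_eq_0_inv in HA0. apply pow_eq_0_inv in HC0. split; [lra| split; [|lra]].
  intros j Hj. pose proof (rsum_zero_each m _ ltac:(intros; apply pow2_ge_0) (Req_le _ _ HB0) j Hj) as Hz.
  cbv beta in Hz. apply pow_eq_0_inv in Hz. lra.
Qed.

Lemma hform_zero_at_infinity n m p g Rb eta beta z :
  peval (n + m + 3) (hform n m p g Rb eta beta) z = 0 -> z (n + m + 2)%nat = 0 ->
  forall i, (i < n + m + 3)%nat -> z i = 0.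
Proof.
  intros Hh Hy. destruct (hform_eq_0 n m p g Rb eta beta z Hh) as [_ [_ HL]].
  pose proof (dd_ge1 n m p g) as Hd. set (d := dd n m p g) in *.
  rewrite Hy, pow_i, Rmult_0_r in HL by lia.
  set (X := rsum n (fun i => z i ^ 2) + rsum (S m) (fun j => z (n + j)%nat ^ 2)) in HL.
  pose proof (rsum_sq_nonneg n z) as Hx.
  assert (Hs : 0 <= rsum (S m) (fun j => z (n + j)%nat ^ 2)) by (apply rsum_nonneg; intros; apply pow2_ge_0).
  assert (HXd : 0 <= X ^ d) by (apply pow_le; unfold X; lra).
  pose proof (pow_even_nonneg (z (n + S m)%nat) d).
  assert (HX : X = 0) by (apply (pow_eq_0_inv _ d); lra).
  assert (Hlast : z (n + S m)%nat = 0) by (apply (pow_eq_0_inv _ (2 * d)); lra).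
  intros i Hi. apply (pow_eq_0_inv _ 2).
  destruct (Nat.lt_ge_cases i n) as [Hl|Hl]; [|destruct (Nat.le_gt_cases i (n + m)) as [Hl2|Hl2]].
  - apply (rsum_zero_each n (fun i => z i ^ 2)); [intros; apply pow2_ge_0| unfold X in HX; lra| auto].
  - replace i with (n + (i - n))%nat by lia.
    apply (rsum_zero_each (S m) (fun j => z (n + j)%nat ^ 2)); [intros; apply pow2_ge_0| unfold X in HX; lra| lia].
  - assert (i = n + S m \/ i = n + m + 2)%nat as [-> | ->] by lia; [rewrite Hlast| rewrite Hy]; ring.
Qed.

Lemma hform_zero_affine n m p g Rb eta beta z :
  let yi := (n + m + 2)%nat in
  peval (n + m + 3) (hform n m p g Rb eta beta) z = 0 -> z yi <> 0 ->
  inS n m g (fun i => z i / z yi) /\ peval n p (fun i => z i / z yi) <= 0.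
Proof.
  intros yi Hh Hy. destruct (hform_eq_0 n m p g Rb eta beta z Hh) as [Hp [Hg _]].
  pose proof (dd_ge1 n m p g) as Hd. set (d := dd n m p g) in *. fold yi in Hp, Hg.
  assert (Hyp : 0 < z yi ^ (2 * d)) by (apply pow_even_pos; auto).
  assert (Hyq : 0 <= z yi ^ (2 * d - 2)).
  { replace (2 * d - 2)%nat with (2 * (d - 1))%nat by lia. apply pow_even_nonneg. }
  split.
  - intros j Hj. specialize (Hg j Hj).
    rewrite peval_homog_y in Hg by (auto; try (unfold yi; lia); intros a Ha; apply (mdeg_g_le n m p g j a Hj Ha)).
    assert (0 <= z (n + S j)%nat ^ 2 * z yi ^ (2 * d - 2)) by (apply Rmult_le_pos; auto; apply pow2_ge_0).
    destruct (Rle_lt_dec 0 (peval n (g j) (fun i => z i / z yi))) as [|Hneg]; auto.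
    assert (z yi ^ (2 * d) * peval n (g j) (fun i => z i / z yi) < 0) by (rewrite Rmult_comm; apply Rmult_neg_pos; auto).
    lra.
  - rewrite peval_homog_y in Hp by (auto; try (unfold yi; lia); intros a Ha; apply (mdeg_p_le n m p g a Ha)).
    assert (0 <= z n ^ 2 * z yi ^ (2 * d - 2)) by (apply Rmult_le_pos; auto; apply pow2_ge_0).
    destruct (Rle_lt_dec (peval n p (fun i => z i / z yi)) 0) as [|Hpos]; auto.
    assert (0 < z yi ^ (2 * d) * peval n p (fun i => z i / z yi)) by (apply Rmult_lt_0_compat; auto). lra.
Qed.

Lemma hform_posdef n m p g Rb eta beta :
  (forall x, inS n m g x -> 0 < peval n p x) ->
  forall z, (exists i, (i < n + m + 3)%nat /\ z i <> 0) ->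
  0 < peval (n + m + 3) (hform n m p g Rb eta beta) z.
Proof.
  intros Hpos z [i0 [Hi0 Hz0]].
  destruct (Rle_lt_or_eq_dec _ _ (hform_nonneg n m p g Rb eta beta z)) as [|Hh]; auto. exfalso.
  destruct (Req_dec (z (n + m + 2)%nat) 0) as [Hy|Hy].
  - exact (Hz0 (hform_zero_at_infinity n m p g Rb eta beta z (eq_sym Hh) Hy i0 Hi0)).
  - destruct (hform_zero_affine n m p g Rb eta beta z (eq_sym Hh) Hy) as [HS Hp].
    specialize (Hpos _ HS). lra.
Qed.

(** * Forms positive off the origin *)

Lemma Rinv_INR_succ_small eps : 0 < eps -> exists N, forall j, (j >= N)%nat -> / (INR j + 1) < eps.
Proof.
  intros He. destruct (archimed_cor1 eps He) as [N [H1 H2]]. exists N. intros j Hj.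
  apply Rle_lt_trans with (/ INR N); auto. apply Rinv_le_contravar.
  - apply lt_0_INR; lia.
  - apply le_INR in Hj. lra.
Qed.

(* Stdlib's Bolzano_Weierstrass only provides an adherence value; extract a subsequence converging to it. *)
Lemma ValAdh_subseq (u : nat -> R) l : ValAdh u l ->
  exists phi : nat -> nat, (forall j, (phi j < phi (S j))%nat) /\ Un_cv (fun j => u (phi j)) l.
Proof.
  intros H.
  assert (Hex : forall N j : nat, exists p, (N <= p)%nat /\ Rabs (u p - l) < / (INR j + 1)).
  { intros N j. assert (Hpos : 0 < / (INR j + 1)).
    { apply Rinv_0_lt_compat. pose proof (pos_INR j). lra. }
    destruct (H (disc l (mkposreal _ Hpos)) N) as [p [Hp1 Hp2]].
    - exists (mkposreal _ Hpos). intros y Hy. exact Hy.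
    - exists p. split; auto. }
  set (F := fun N j => proj1_sig (constructive_indefinite_description _ (Hex N j))).
  assert (HF : forall N j, (N <= F N j)%nat /\ Rabs (u (F N j) - l) < / (INR j + 1)).
  { intros N j. unfold F. destruct (constructive_indefinite_description _ (Hex N j)); auto. }
  set (phi := fix phi j := match j with O => F O O | S j' => F (S (phi j')) (S j') end).
  exists phi. split.
  - intros j. simpl. destruct (HF (S (phi j)) (S j)). lia.
  - intros eps He. destruct (Rinv_INR_succ_small eps He) as [N HN]. exists N. intros j Hj.
    unfold Rdist. assert (Rabs (u (phi j) - l) < / (INR j + 1)).
    { destruct j; simpl; apply HF. }
    specialize (HN j Hj). lra.
Qed.

Lemma strict_incr_ge (phi : nat -> nat) : (forall j, (phi j < phi (S j))%nat) -> forall j, (j <= phi j)%nat.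
Proof. intros H j. induction j; [lia|]. specialize (H j). lia. Qed.

Lemma strict_incr_le (phi : nat -> nat) : (forall j, (phi j < phi (S j))%nat) ->
  forall a b, (a <= b)%nat -> (phi a <= phi b)%nat.
Proof. intros H a b Hab. induction Hab; auto. specialize (H m). lia. Qed.

Lemma Un_cv_subseq (a : nat -> R) l (psi : nat -> nat) : (forall j, (psi j < psi (S j))%nat) ->
  Un_cv a l -> Un_cv (fun j => a (psi j)) l.
Proof.
  intros Hp Ha eps He. destruct (Ha eps He) as [N HN]. exists N. intros j Hj.
  apply HN. pose proof (strict_incr_ge psi Hp j). lia.
Qed.

Lemma bounded_subseq_cv (u : nat -> R) : (forall j, -1 <= u j <= 1) ->
  exists phi l, (forall j, (phi j < phi (S j))%nat) /\ Un_cv (fun j => u (phi j)) l.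
Proof.
  intros H. destruct (Bolzano_Weierstrass u (fun c => -1 <= c <= 1) (compact_P3 (-1) 1) H) as [l Hl].
  destruct (ValAdh_subseq u l Hl) as [phi Hphi]. exists phi, l. auto.
Qed.

Lemma bounded_subseq_cv_vec k (u : nat -> nat -> R) : (forall j i, -1 <= u j i <= 1) ->
  exists (phi : nat -> nat) (l : nat -> R), (forall j, (phi j < phi (S j))%nat) /\
     forall i, (i < k)%nat -> Un_cv (fun j => u (phi j) i) (l i).
Proof.
  intros H. induction k as [|k IH].
  - exists (fun j => j), (fun _ => 0). split; [intros; lia| intros; lia].
  - destruct IH as [phi [l [Hp Hl]]].
    destruct (bounded_subseq_cv (fun j => u (phi j) k) (fun j => H (phi j) k)) as [psi [lk [Hq Hk]]].
    exists (fun j => phi (psi j)), (fun i => if Nat.eqb i k then lk else l i). split.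
    + intros j. specialize (Hq j). apply (strict_incr_le phi Hp) in Hq. specialize (Hp (psi j)). lia.
    + intros i Hi. destruct (Nat.eqb i k) eqn:E.
      * apply Nat.eqb_eq in E; subst. auto.
      * apply Nat.eqb_neq in E. apply (Un_cv_subseq (fun j => u (phi j) i)); auto. apply Hl. lia.
Qed.

Lemma Un_cv_const c : Un_cv (fun _ => c) c.
Proof. intros eps He. exists O. intros. unfold Rdist. rewrite Rminus_diag, Rabs_R0. lra. Qed.

Lemma Un_cv_pow (a : nat -> R) l e : Un_cv a l -> Un_cv (fun j => a j ^ e) (l ^ e).
Proof. intros H. induction e; simpl; [apply Un_cv_const| apply CV_mult; auto]. Qed.

Lemma Un_cv_peval k P (x : nat -> nat -> R) (l : nat -> R) :
  (forall i, (i < k)%nat -> Un_cv (fun j => x j i) (l i)) ->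
  Un_cv (fun j => peval k P (x j)) (peval k P l).
Proof.
  intros H. induction P as [|t P IH].
  - unfold peval; simpl. apply Un_cv_const.
  - unfold peval in *. simpl. apply CV_plus; auto. apply CV_mult; [apply Un_cv_const|].
    unfold rprod. assert (Hl : forall i, In i (seq 0 k) -> (i < k)%nat) by (intros i Hi; apply in_seq in Hi; lia).
    induction (seq 0 k) as [|i s IHs]; simpl; [apply Un_cv_const|].
    apply CV_mult; [apply Un_cv_pow, H, Hl; left; auto| apply IHs; intros; apply Hl; right; auto].
Qed.

Lemma Un_cv_rsum k (f : nat -> nat -> R) g : (forall i, (i < k)%nat -> Un_cv (fun j => f j i) (g i)) ->
  Un_cv (fun j => rsum k (f j)) (rsum k g).
Proof.
  intros H. unfold rsum. assert (Hl : forall i, In i (seq 0 k) -> (i < k)%nat) by (intros i Hi; apply in_seq in Hi; lia).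
  induction (seq 0 k) as [|i s IH]; simpl; [apply Un_cv_const|].
  apply CV_plus; [apply H, Hl; left; auto| apply IH; intros; apply Hl; right; auto].
Qed.

Lemma Un_cv_le_0 (a : nat -> R) l : Un_cv a l -> (forall j, a j < / (INR j + 1)) -> l <= 0.
Proof.
  intros Ha Hb. destruct (Rle_lt_dec l 0) as [|Hl]; auto. exfalso.
  destruct (Ha (l / 2) ltac:(lra)) as [N1 HN1]. destruct (Rinv_INR_succ_small (l / 2) ltac:(lra)) as [N2 HN2].
  specialize (HN1 (N1 + N2)%nat ltac:(lia)). specialize (HN2 (N1 + N2)%nat ltac:(lia)).
  specialize (Hb (N1 + N2)%nat). unfold Rdist in HN1. apply Rabs_def2 in HN1. lra.
Qed.

(* Bolzano-Weierstrass: otherwise points of the unit sphere with P < 1/(j+1) accumulate at a zero of P. *)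
Lemma posdef_min_on_sphere k P :
  (forall z, (exists i, (i < k)%nat /\ z i <> 0) -> 0 < peval k P z) ->
  exists c, 0 < c /\ forall u, rsum k (fun i => u i ^ 2) = 1 -> c <= peval k P u.
Proof.
  intros Hpd. apply NNPP. intros Hno.
  assert (Hex : forall j : nat, exists u, rsum k (fun i => u i ^ 2) = 1 /\ peval k P u < / (INR j + 1)).
  { intros j. apply NNPP. intros Hn. apply Hno. exists (/ (INR j + 1)). split.
    - apply Rinv_0_lt_compat. pose proof (pos_INR j). lra.
    - intros u Hu. apply Rnot_lt_le. intros Hlt. apply Hn. exists u. auto. }
  set (us := fun j => proj1_sig (constructive_indefinite_description _ (Hex j))).
  assert (Hus : forall j, rsum k (fun i => us j i ^ 2) = 1 /\ peval k P (us j) < / (INR j + 1)).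
  { intros j. unfold us. destruct (constructive_indefinite_description _ (Hex j)); auto. }
  set (u := fun j i => if Nat.ltb i k then us j i else 0).
  assert (Hu : forall j i, (i < k)%nat -> u j i = us j i).
  { intros j i Hi. unfold u. destruct (Nat.ltb_spec i k); [auto|lia]. }
  assert (Hub : forall j i, -1 <= u j i <= 1).
  { intros j i. destruct (Nat.lt_ge_cases i k) as [Hi|Hi].
    - pose proof (rsum_ge_term k (fun i => us j i ^ 2) i ltac:(intros; apply pow2_ge_0) Hi) as Hle.
      rewrite (proj1 (Hus j)) in Hle. rewrite Hu by auto. cbv beta in Hle. split; nra.
    - unfold u. destruct (Nat.ltb_spec i k); [lia| lra]. }
  destruct (bounded_subseq_cv_vec k u Hub) as [phi [l [Hp Hl]]].
  assert (Hle : peval k P l <= 0).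
  { apply (Un_cv_le_0 _ _ (Un_cv_peval k P (fun j => u (phi j)) l Hl)). intros j.
    rewrite (peval_ext k P _ (us (phi j))) by (intros; apply Hu; auto).
    eapply Rlt_le_trans; [apply Hus|]. apply Rinv_le_contravar; [pose proof (pos_INR j); lra|].
    apply Rplus_le_compat_r, le_INR, strict_incr_ge; auto. }
  assert (Hn1 : rsum k (fun i => l i ^ 2) = 1).
  { apply (UL_sequence (fun j => rsum k (fun i => u (phi j) i ^ 2))).
    - apply (Un_cv_rsum k (fun j i => u (phi j) i ^ 2)). intros i Hi. apply Un_cv_pow, Hl; auto.
    - intros eps He. exists O. intros j _.
      rewrite (rsum_ext_in k _ (fun i => us (phi j) i ^ 2)) by (intros; rewrite Hu; auto).
      rewrite (proj1 (Hus (phi j))). unfold Rdist. rewrite Rminus_diag, Rabs_R0. lra. }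
  specialize (Hpd l (nonzero_of_rsum_sq_pos k l ltac:(lra))). lra.
Qed.

Lemma posdef_form_lower_bound k D P : (0 < D)%nat -> is_homog k (2 * D) P ->
  (forall z, (exists i, (i < k)%nat /\ z i <> 0) -> 0 < peval k P z) ->
  exists c, 0 < c /\ forall z, c * rsum k (fun i => z i ^ 2) ^ D <= peval k P z.
Proof.
  intros HD HH Hpd. destruct (posdef_min_on_sphere k P Hpd) as [c [Hc Hmin]].
  exists c. split; auto. intros z.
  set (s := rsum k (fun i => z i ^ 2)).
  destruct (Rle_lt_or_eq_dec 0 s (rsum_sq_nonneg k z)) as [Hs|Hs].
  - set (t := sqrt s). assert (Ht : 0 < t) by (apply sqrt_lt_R0; auto).
    assert (Hu : rsum k (fun i => (/ t * z i) ^ 2) = 1).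
    { rewrite (rsum_ext_in k _ (fun i => (/ t) ^ 2 * z i ^ 2)) by (intros; ring).
      rewrite rsum_scal. fold s. rewrite pow_inv by lra. unfold t. rewrite pow2_sqrt by lra. field. lra. }
    specialize (Hmin _ Hu). rewrite (peval_scale k (2 * D) P _ z HH), pow_inv in Hmin by lra.
    replace (s ^ D) with (t ^ (2 * D)) by (unfold t; apply sqrt_pow_even; lra).
    assert (0 < t ^ (2 * D)) by (apply pow_lt; auto).
    apply (Rmult_le_reg_l (/ t ^ (2 * D))); [apply Rinv_0_lt_compat; auto|].
    replace (/ t ^ (2 * D) * (c * t ^ (2 * D))) with c by (field; lra). lra.
  - rewrite <- Hs, pow_i by lia. rewrite (peval_ext k P z (fun i => 0 * z i)).
    + rewrite (peval_scale k (2 * D) P 0 z HH), pow_i by lia. lra.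
    + intros i Hi. assert (Hz : z i ^ 2 = 0).
      { apply (rsum_zero_each k (fun i => z i ^ 2)); [intros; apply pow2_ge_0| fold s; lra| auto]. }
      apply pow_eq_0_inv in Hz. rewrite Hz. ring.
Qed.

(** * Powers of the sum of squares *)

Definition mle (k : nat) (b a : mono) : bool := forallb (fun i => Nat.leb (b i) (a i)) (seq 0 k).

Definition msub (a b : mono) : mono := fun i => (a i - b i)%nat.

Lemma mle_spec k b a : mle k b a = true <-> (forall i, (i < k)%nat -> (b i <= a i)%nat).
Proof.
  unfold mle. rewrite forallb_forall. split.
  - intros H i Hi. apply Nat.leb_le. apply H. apply in_seq. lia.
  - intros H i Hi. apply in_seq in Hi. apply Nat.leb_le. apply H. lia.
Qed.

Lemma mle_meq K b b' a : meq K b b' -> mle K b a = mle K b' a.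
Proof.
  intros H. destruct (mle K b a) eqn:E1, (mle K b' a) eqn:E2; auto.
  - rewrite mle_spec in E1. assert (mle K b' a = true); [|congruence]. apply mle_spec. intros i Hi. rewrite <- H; auto.
  - rewrite mle_spec in E2. assert (mle K b a = true); [|congruence]. apply mle_spec. intros i Hi. rewrite H; auto.
Qed.

Lemma mle_false K b a : mle K b a = false -> exists j, (j < K)%nat /\ (a j < b j)%nat.
Proof.
  intros H. apply NNPP. intros Hn. assert (mle K b a = true); [|congruence].
  apply mle_spec. intros i Hi. destruct (Nat.le_gt_cases (b i) (a i)); auto. exfalso; apply Hn; exists i; auto.
Qed.

Lemma coef_pmul_sub k P Q a :
  coef k (pmul P Q) a = tsum (fun b => if mle k b a then coef k Q (msub a b) else 0) P.
Proof.
  rewrite coef_pmul. apply tsum_ext. intros b. destruct (mle k b a) eqn:E.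
  - rewrite coef_tsum. apply tsum_ext. intros b'. unfold mon_ind.
    rewrite mle_spec in E.
    destruct (mon_eqb k (madd b b') a) eqn:E1, (mon_eqb k b' (msub a b)) eqn:E2; auto; exfalso.
    + apply mon_eqb_spec in E1. assert (meq k b' (msub a b)).
      { intros i Hi. unfold msub. rewrite <- (E1 i Hi). unfold madd. lia. }
      apply mon_eqb_spec in H. congruence.
    + apply mon_eqb_spec in E2. assert (meq k (madd b b') a).
      { intros i Hi. unfold madd. rewrite (E2 i Hi). unfold msub. specialize (E i Hi). lia. }
      apply mon_eqb_spec in H. congruence.
  - rewrite (tsum_ext _ (fun _ => 0)). apply tsum_zero. intros b'. unfold mon_ind.
    destruct (mon_eqb k (madd b b') a) eqn:E1; auto. exfalso.
    apply mon_eqb_spec in E1. assert (mle k b a = true); [|congruence].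
    apply mle_spec. intros i Hi. rewrite <- (E1 i Hi). unfold madd. lia.
Qed.

Definition evec2 (i : nat) : mono := fun j => if Nat.eqb j i then 2%nat else 0%nat.

Lemma tsum_pvar_sq f i : tsum f (ppow (pvar i) 2) = f (evec2 i).
Proof.
  simpl. unfold tsum. simpl. replace (fun i0 : nat => ((if Nat.eqb i0 i then 1 else 0) + ((if Nat.eqb i0 i then 1 else 0) + 0))%nat) with (evec2 i).
  ring. apply functional_extensionality. intros j. unfold evec2. destruct (Nat.eqb j i); lia.
Qed.

Definition sqsum (N : nat) : mpoly :=
  padd (psum N (fun i => ppow (pvar i) 2)) (psum N (fun i => ppow (pvar (N + i)) 2)).

Lemma tsum_sqsum f N : tsum f (sqsum N) = rsum (N + N) (fun i => f (evec2 i)).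
Proof.
  unfold sqsum. rewrite tsum_padd, !tsum_psum, rsum_split. f_equal; unfold rsum; f_equal; apply map_ext; intros; apply tsum_pvar_sq.
Qed.

Definition even_mono (k : nat) (c : mono) : bool := forallb (fun i => Nat.even (c i)) (seq 0 k).

Definition half_fact (k : nat) (c : mono) : R := rprod k (fun i => INR (fact (c i / 2))).

Definition sqsum_pow_coef (k M : nat) (c : mono) : R :=
  if andb (even_mono k c) (Nat.eqb (mdeg k c) (2 * M)) then INR (fact M) / half_fact k c else 0.

Lemma even_mono_spec k c : even_mono k c = true <-> (forall i, (i < k)%nat -> Nat.even (c i) = true).
Proof.
  unfold even_mono. rewrite forallb_forall. split.
  - intros H i Hi. apply H, in_seq; lia.
  - intros H i Hi. apply in_seq in Hi. apply H; lia.
Qed.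

Lemma even_mono_meq K c c' : meq K c c' -> even_mono K c = even_mono K c'.
Proof.
  intros H. destruct (even_mono K c) eqn:E1, (even_mono K c') eqn:E2; auto.
  - rewrite even_mono_spec in E1. assert (even_mono K c' = true); [|congruence]. apply even_mono_spec. intros i Hi. rewrite <- H; auto.
  - rewrite even_mono_spec in E2. assert (even_mono K c = true); [|congruence]. apply even_mono_spec. intros i Hi. rewrite H; auto.
Qed.

Lemma half_fact_meq K c c' : meq K c c' -> half_fact K c = half_fact K c'.
Proof. intros H. unfold half_fact, rprod. f_equal. apply map_ext_in. intros i Hi. apply in_seq in Hi. rewrite H; auto. lia. Qed.

Lemma sqsum_pow_coef_meq K M c c' : meq K c c' -> sqsum_pow_coef K M c = sqsum_pow_coef K M c'.
Proof. intros H. unfold sqsum_pow_coef. rewrite (even_mono_meq K c c' H), (mdeg_meq K c c' H), (half_fact_meq K c c' H). auto. Qed.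

Lemma mdeg_msub_l (l : list nat) (a b : mono) : (forall i, In i l -> (b i <= a i)%nat) ->
  fold_right Nat.add 0%nat (map (msub a b) l) =
  (fold_right Nat.add 0%nat (map a l) - fold_right Nat.add 0%nat (map b l))%nat /\
  (fold_right Nat.add 0%nat (map b l) <= fold_right Nat.add 0%nat (map a l))%nat.
Proof.
  induction l as [|x l IH]; intros H; simpl; [lia|].
  destruct IH as [IH1 IH2]. intros; apply H; right; auto.
  assert (b x <= a x)%nat by (apply H; left; auto). unfold msub at 1. lia.
Qed.

Lemma mdeg_msub k a b : (forall i, (i < k)%nat -> (b i <= a i)%nat) ->
  mdeg k (msub a b) = (mdeg k a - mdeg k b)%nat /\ (mdeg k b <= mdeg k a)%nat.
Proof. intros H. apply mdeg_msub_l. intros i Hi; apply in_seq in Hi; apply H; lia. Qed.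

Lemma mdeg_evec2 k i : (i < k)%nat -> mdeg k (evec2 i) = 2%nat.
Proof.
  intros Hi. unfold mdeg, evec2. rewrite fold_ind_v by apply seq_NoDup.
  destruct (existsb (Nat.eqb i) (seq 0 k)) eqn:E; auto.
  exfalso. assert (existsb (Nat.eqb i) (seq 0 k) = true); [|congruence].
  apply existsb_exists. exists i. split; [apply in_seq; lia| apply Nat.eqb_refl].
Qed.

Lemma half_fact_pos k c : 0 < half_fact k c.
Proof.
  unfold half_fact, rprod. induction (seq 0 k); simpl; [lra|]. apply Rmult_lt_0_compat; auto.
  apply lt_0_INR. apply lt_O_fact.
Qed.

Lemma half_fact_step k c i : (i < k)%nat -> (2 <= c i)%nat -> Nat.even (c i) = true ->
  half_fact k c = INR (c i / 2) * half_fact k (msub c (evec2 i)).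
Proof.
  intros Hi H2 He. unfold half_fact, rprod.
  fold (lprod (seq 0 k) (fun j => INR (fact (c j / 2)))).
  fold (lprod (seq 0 k) (fun j => INR (fact (msub c (evec2 i) j / 2)))).
  assert (Hin : In i (seq 0 k)) by (apply in_seq; lia).
  set (R0 := lprod (seq 0 k) (fun j => if Nat.eqb j i then 1 else INR (fact (c j / 2)))).
  assert (HA : lprod (seq 0 k) (fun j => INR (fact (c j / 2))) = INR (fact (c i / 2)) * R0).
  { unfold R0. apply (lprod_point _ (fun j => INR (fact (c j / 2))) i Hin (seq_NoDup _ _)). }
  assert (HB : lprod (seq 0 k) (fun j => INR (fact (msub c (evec2 i) j / 2))) = INR (fact ((c i - 2) / 2)) * R0).
  { rewrite (lprod_point _ _ i Hin (seq_NoDup _ _)). unfold msub at 1, evec2 at 1. rewrite Nat.eqb_refl. f_equal.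
    apply lprod_ext_in. intros j _. destruct (Nat.eqb j i) eqn:E; auto. unfold msub, evec2. rewrite E.
    rewrite Nat.sub_0_r. auto. }
  rewrite HA, HB. destruct (even_ex _ He) as [w Hw]. rewrite Hw.
  rewrite half_double. replace (2 * w - 2)%nat with (2 * (w - 1))%nat by lia. rewrite half_double.
  replace w with (S (w - 1)) at 1 2 by lia. rewrite fact_simpl, mult_INR.
  ring.
Qed.

Lemma mdeg_zero_iff k c : mdeg k c = 0%nat <-> (forall i, (i < k)%nat -> c i = 0%nat).
Proof.
  unfold mdeg. rewrite fold_zero_iff. split; intros H i Hi.
  - apply H, in_seq; lia.
  - apply in_seq in Hi. apply H; lia.
Qed.

Lemma rsum_half_mdeg k a s : even_mono k a = true -> mdeg k a = (2 * s)%nat ->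
  rsum k (fun i => INR (a i / 2)) = INR s.
Proof.
  intros Ea Ha. rewrite rsum_INR. f_equal.
  pose proof (fold_half (seq 0 k) a) as Hh. unfold mdeg in Ha. rewrite <- Hh in Ha; [lia|].
  intros i Hi. apply in_seq in Hi. rewrite even_mono_spec in Ea. apply Ea. lia.
Qed.

Lemma mle_evec2 k i c : (i < k)%nat -> mle k (evec2 i) c = Nat.leb 2 (c i).
Proof.
  intros Hi. destruct (Nat.leb 2 (c i)) eqn:E.
  - apply mle_spec. intros j Hj. unfold evec2. destruct (Nat.eqb j i) eqn:E2; [|lia].
    apply Nat.eqb_eq in E2; subst. apply Nat.leb_le; auto.
  - destruct (mle k (evec2 i) c) eqn:E2; auto. rewrite mle_spec in E2. specialize (E2 i Hi).
    unfold evec2 in E2. rewrite Nat.eqb_refl in E2. apply Nat.leb_gt in E. lia.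
Qed.

Lemma evec2_le i c : (2 <= c i)%nat -> forall j, (evec2 i j <= c j)%nat.
Proof. intros H2 j. unfold evec2. destruct (Nat.eqb_spec j i); [subst|]; lia. Qed.

Lemma evec2_even i j : Nat.Even (evec2 i j).
Proof. unfold evec2. destruct (Nat.eqb j i); [exists 1%nat | exists 0%nat]; reflexivity. Qed.

Lemma even_mono_msub K a b : (forall i, (i < K)%nat -> Nat.Even (b i)) ->
  (forall i, (i < K)%nat -> (b i <= a i)%nat) -> even_mono K (msub a b) = even_mono K a.
Proof.
  intros Eb Hle. apply Bool.eq_iff_eq_true. rewrite !even_mono_spec.
  split; intros H i Hi; specialize (H i Hi); destruct (Eb i Hi) as [v Hv]; specialize (Hle i Hi);
    unfold msub in *; apply Nat.even_spec; apply Nat.even_spec in H; destruct H as [u Hu].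
  - exists (u + v)%nat. lia.
  - exists (u - v)%nat. lia.
Qed.

Lemma mdeg_msub_evec2 k i c : (i < k)%nat -> (2 <= c i)%nat ->
  (mdeg k (msub c (evec2 i)) + 2)%nat = mdeg k c.
Proof.
  intros Hi H2. destruct (mdeg_msub k c (evec2 i) (fun j _ => evec2_le i c H2 j)) as [H1 H3]. rewrite mdeg_evec2 in H1, H3 by auto. lia.
Qed.

Lemma sqsum_pow_coef_msub_evec2 k M c i : (i < k)%nat -> (2 <= c i)%nat ->
  sqsum_pow_coef k M (msub c (evec2 i)) = INR (c i / 2) / INR (S M) * sqsum_pow_coef k (S M) c.
Proof.
  intros Hi H2. unfold sqsum_pow_coef.
  rewrite even_mono_msub by (intros; first [apply evec2_even| apply evec2_le; auto]).
  pose proof (mdeg_msub_evec2 k i c Hi H2) as Hd.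
  replace (Nat.eqb (mdeg k (msub c (evec2 i))) (2 * M)) with (Nat.eqb (mdeg k c) (2 * S M))
    by (apply Bool.eq_iff_eq_true; rewrite !Nat.eqb_eq; lia).
  destruct (andb (even_mono k c) (Nat.eqb (mdeg k c) (2 * S M))) eqn:E; [|ring].
  apply andb_prop in E. destruct E as [Ev _]. rewrite even_mono_spec in Ev.
  rewrite (half_fact_step k c i Hi H2 (Ev i Hi)), fact_simpl, mult_INR.
  pose proof (half_fact_pos k (msub c (evec2 i))).
  assert (0 < INR (c i / 2)) by (apply lt_0_INR; apply Nat.div_str_pos; lia).
  field. repeat split; try lra. apply not_0_INR. lia.
Qed.

Lemma half_fact_zero k c : (forall i, (i < k)%nat -> c i = 0%nat) -> half_fact k c = 1.
Proof.
  intros Hc. unfold half_fact, rprod. fold (lprod (seq 0 k) (fun i => INR (fact (c i / 2)))).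
  rewrite <- (lprod_one (seq 0 k)). apply lprod_ext_in. intros i Hi. apply in_seq in Hi.
  rewrite Hc by lia. reflexivity.
Qed.

Lemma coef_sqsum_pow N M c : coef (N + N) (ppow (sqsum N) M) c = sqsum_pow_coef (N + N) M c.
Proof.
  set (k := (N + N)%nat). revert c. induction M as [|M IH]; intros c.
  - simpl ppow. unfold coef, pconst, sqsum_pow_coef. simpl filter.
    assert (Hz : mon_eqb k (fun _ => 0%nat) c = Nat.eqb (mdeg k c) 0).
    { apply Bool.eq_iff_eq_true. rewrite mon_eqb_spec, Nat.eqb_eq, mdeg_zero_iff.
      split; intros H i Hi; symmetry; apply H; auto. }
    rewrite Hz. change (2 * 0)%nat with 0%nat.
    destruct (Nat.eqb_spec (mdeg k c) 0) as [Hc|]; [|rewrite Bool.andb_false_r; reflexivity].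
    rewrite mdeg_zero_iff in Hc.
    replace (even_mono k c) with true by (symmetry; apply even_mono_spec; intros i Hi; rewrite Hc; auto).
    rewrite half_fact_zero by auto. simpl. field.
  - change (ppow (sqsum N) (S M)) with (pmul (sqsum N) (ppow (sqsum N) M)).
    rewrite coef_pmul_sub, (tsum_ext _ (fun b => if mle k b c then sqsum_pow_coef k M (msub c b) else 0))
      by (intros b; destruct (mle k b c); auto).
    unfold k at 3. rewrite tsum_sqsum. fold k.
    rewrite (rsum_ext_in k _ (fun i => sqsum_pow_coef k (S M) c / INR (S M) * INR (c i / 2))).
    2:{ intros i Hi. rewrite mle_evec2 by auto. destruct (Nat.leb_spec 2 (c i)).
        - rewrite sqsum_pow_coef_msub_evec2 by auto. field. apply not_0_INR. lia.
        - replace (c i / 2)%nat with 0%nat by (symmetry; apply Nat.div_small; lia). simpl. ring. }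
    rewrite rsum_scal. unfold sqsum_pow_coef.
    destruct (andb (even_mono k c) (Nat.eqb (mdeg k c) (2 * S M))) eqn:E; [|unfold Rdiv; ring].
    apply andb_prop in E. destruct E as [Ev Em]. apply Nat.eqb_eq in Em.
    rewrite (rsum_half_mdeg k c (S M) Ev Em). pose proof (half_fact_pos k c).
    field. split; [lra| apply not_0_INR; lia].
Qed.

(** * Polya's estimate *)

Fixpoint falling (n k : nat) : R :=
  match k with O => 1 | S k' => falling n k' * (INR n - INR k') end.

Lemma falling_zero n k : (n < k)%nat -> falling n k = 0.
Proof.
  induction k; intros H; [lia|]. simpl. destruct (Nat.eq_dec k n) as [->|Hne].
  - ring.
  - rewrite IHk by lia. ring.
Qed.

Lemma falling_fact n k : (k <= n)%nat -> INR (fact n) = INR (fact (n - k)) * falling n k.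
Proof.
  induction k; intros H.
  - simpl. rewrite Nat.sub_0_r. ring.
  - rewrite IHk by lia. simpl falling. replace (n - k)%nat with (S (n - S k)) by lia.
    rewrite fact_simpl, mult_INR. replace (INR (S (n - S k))) with (INR n - INR k).
    ring. rewrite S_INR, minus_INR by lia. rewrite S_INR. ring.
Qed.

Lemma falling_bound n k T : INR n <= T -> INR k <= T -> Rabs (falling n k) <= T ^ k.
Proof.
  intros Hn Hk. induction k; simpl; [rewrite Rabs_R1; lra|].
  rewrite Rabs_mult. rewrite S_INR in Hk. pose proof (pos_INR k). pose proof (pos_INR n).
  assert (Rabs (INR n - INR k) <= T) by (apply Rabs_le; split; lra).
  rewrite Rmult_comm. apply Rmult_le_compat; auto using Rabs_pos. apply IHk. lra.
Qed.

Lemma falling_close n k T D : 0 < T -> INR n <= T -> (k <= D)%nat -> INR D <= T ->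
  Rabs (INR n ^ k - falling n k) * T <= INR D * INR k * T ^ k.
Proof.
  intros HT Hn Hk HD. induction k.
  - simpl. rewrite Rminus_diag, Rabs_R0. lra.
  - assert (IH := IHk ltac:(lia)). simpl pow. simpl falling.
    replace (INR n * INR n ^ k - falling n k * (INR n - INR k)) with
      ((INR n ^ k - falling n k) * INR n + falling n k * INR k) by ring.
    pose proof (pos_INR n). pose proof (pos_INR k).
    assert (Hk' : INR k <= T) by (apply le_INR in Hk; rewrite S_INR in Hk; lra).
    assert (Hb : Rabs (falling n k) <= T ^ k) by (apply falling_bound; lra).
    assert (HkD : INR k + 1 <= INR D) by (rewrite <- S_INR; apply le_INR; lia).
    eapply Rle_trans. { apply Rmult_le_compat_r; [lra| apply Rabs_triang]. }
    rewrite !Rabs_mult, (Rabs_right (INR n)), (Rabs_right (INR k)) by lra.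
    assert (Tk : 0 <= T ^ k) by (apply pow_le; lra).
    assert (H1 : Rabs (INR n ^ k - falling n k) * INR n * T <= INR D * INR k * T ^ k * T).
    { replace (Rabs (INR n ^ k - falling n k) * INR n * T) with (Rabs (INR n ^ k - falling n k) * T * INR n) by ring.
      apply Rmult_le_compat; auto. apply Rmult_le_pos; auto using Rabs_pos; lra. }
    assert (H2 : Rabs (falling n k) * INR k * T <= T ^ k * INR D * T).
    { apply Rmult_le_compat_r; [lra|]. apply Rmult_le_compat; auto using Rabs_pos. lra. }
    rewrite S_INR. nra.
Qed.

Lemma lprod_falling_close (l : list nat) (g be : nat -> nat) T D : 0 < T -> INR D <= T ->
  (forall i, In i l -> INR (g i) <= T /\ (be i <= D)%nat) ->
  let E := fold_right Nat.add 0%nat (map be l) in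
  Rabs (lprod l (fun i => INR (g i) ^ be i)) <= T ^ E /\
  Rabs (lprod l (fun i => falling (g i) (be i))) <= T ^ E /\
  Rabs (lprod l (fun i => INR (g i) ^ be i) - lprod l (fun i => falling (g i) (be i))) * T
    <= INR D * INR E * T ^ E.
Proof.
  intros HT HD H. induction l as [|x l IH]; intros E; unfold E; simpl.
  - unfold lprod; simpl. rewrite Rminus_diag, Rabs_R0, Rabs_R1. lra.
  - destruct IH as [I1 [I2 I3]]. intros; apply H; right; auto.
    destruct (H x (or_introl eq_refl)) as [Hg Hb].
    unfold lprod in *; simpl.
    set (A := fold_right Rmult 1 (map (fun i => INR (g i) ^ be i) l)) in *.
    set (B := fold_right Rmult 1 (map (fun i => falling (g i) (be i)) l)) in *.
    set (E' := fold_right Nat.add 0%nat (map be l)) in *.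
    pose proof (pos_INR (g x)).
    assert (Ha : Rabs (INR (g x) ^ be x) <= T ^ be x).
    { rewrite <- RPow_abs. apply pow_incr. rewrite Rabs_right; lra. }
    assert (Hf : Rabs (falling (g x) (be x)) <= T ^ be x).
    { apply falling_bound; auto. apply le_INR in Hb. lra. }
    assert (Hc := falling_close (g x) (be x) T D HT Hg Hb HD).
    assert (TE : 0 <= T ^ E') by (apply pow_le; lra). assert (Tb : 0 <= T ^ be x) by (apply pow_le; lra).
    rewrite pow_add. split; [|split].
    + rewrite Rabs_mult. apply Rmult_le_compat; auto using Rabs_pos.
    + rewrite Rabs_mult. apply Rmult_le_compat; auto using Rabs_pos.
    + replace (INR (g x) ^ be x * A - falling (g x) (be x) * B) with
        ((INR (g x) ^ be x - falling (g x) (be x)) * A + falling (g x) (be x) * (A - B)) by ring.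
      eapply Rle_trans. { apply Rmult_le_compat_r; [lra| apply Rabs_triang]. }
      rewrite !Rabs_mult. rewrite plus_INR.
      assert (H1 : Rabs (INR (g x) ^ be x - falling (g x) (be x)) * Rabs A * T <= INR D * INR (be x) * T ^ be x * T ^ E').
      { replace (Rabs (INR (g x) ^ be x - falling (g x) (be x)) * Rabs A * T) with
          (Rabs (INR (g x) ^ be x - falling (g x) (be x)) * T * Rabs A) by ring.
        apply Rmult_le_compat; auto using Rabs_pos. apply Rmult_le_pos; auto using Rabs_pos; lra. }
      assert (H2 : Rabs (falling (g x) (be x)) * Rabs (A - B) * T <= T ^ be x * (INR D * INR E' * T ^ E')).
      { rewrite Rmult_assoc. apply Rmult_le_compat; auto using Rabs_pos.
        apply Rmult_le_pos; auto using Rabs_pos; lra. }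
      nra.
Qed.

Lemma half_fact_msub K a b : even_mono K a = true -> (forall i, (i < K)%nat -> Nat.Even (b i)) ->
  (forall i, (i < K)%nat -> (b i <= a i)%nat) ->
  half_fact K a = half_fact K (msub a b) * lprod (seq 0 K) (fun i => falling (a i / 2) (b i / 2)).
Proof.
  intros Ea Eb Hle. rewrite even_mono_spec in Ea. unfold half_fact, rprod.
  fold (lprod (seq 0 K) (fun i => INR (fact (a i / 2)))).
  fold (lprod (seq 0 K) (fun i => INR (fact (msub a b i / 2)))).
  rewrite <- lprod_mul. apply lprod_ext_in. intros i Hi. apply in_seq in Hi.
  destruct (even_ex _ (Ea i ltac:(lia))) as [u Hu]. destruct (Eb i ltac:(lia)) as [v Hv].
  specialize (Hle i ltac:(lia)). unfold msub. rewrite Hu, Hv in *.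
  replace (2 * u - 2 * v)%nat with (2 * (u - v))%nat by lia. rewrite !half_double.
  apply falling_fact. lia.
Qed.

Lemma sqsum_pow_coef_msub K M D a b : (forall i, (i < K)%nat -> Nat.Even (b i)) -> mdeg K b = D ->
  (if mle K b a then sqsum_pow_coef K M (msub a b) else 0)
  = (if andb (even_mono K a) (Nat.eqb (mdeg K a) (2 * M + D)) then INR (fact M) / half_fact K a else 0)
    * lprod (seq 0 K) (fun i => falling (a i / 2) (b i / 2)).
Proof.
  intros Eb Hb. destruct (mle K b a) eqn:El.
  - rewrite mle_spec in El. destruct (mdeg_msub K a b El) as [Hm1 Hm2].
    unfold sqsum_pow_coef. rewrite even_mono_msub by auto.
    replace (Nat.eqb (mdeg K (msub a b)) (2 * M)) with (Nat.eqb (mdeg K a) (2 * M + D))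
      by (apply Bool.eq_iff_eq_true; rewrite !Nat.eqb_eq; lia).
    destruct (even_mono K a) eqn:Ea; [|simpl; ring].
    destruct (Nat.eqb (mdeg K a) (2 * M + D)); [|simpl; ring]. cbn [andb].
    rewrite (half_fact_msub K a b Ea Eb El).
    pose proof (half_fact_pos K (msub a b)).
    assert (Hp : lprod (seq 0 K) (fun i => falling (a i / 2) (b i / 2)) <> 0).
    { intros Hz. pose proof (half_fact_pos K a). rewrite (half_fact_msub K a b Ea Eb El), Hz in H0. lra. }
    field. split; [exact Hp| lra].
  - destruct (mle_false K b a El) as [j [Hj Hlt]].
    rewrite (lprod_has_zero _ _ j); [ring| apply in_seq; lia|].
    apply falling_zero. destruct (Eb j Hj) as [v Hv]. rewrite Hv in *. rewrite half_double.
    apply Nat.Div0.div_lt_upper_bound. lia.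
Qed.

Lemma coef_mul_sqsum_pow N X M D : even_exps (N + N) X -> is_homog (N + N) D X -> forall a,
  coef (N + N) (pmul X (ppow (sqsum N) M)) a =
    (if andb (even_mono (N + N) a) (Nat.eqb (mdeg (N + N) a) (2 * M + D))
     then INR (fact M) / half_fact (N + N) a else 0) *
    tsum (fun b => if Nat.eqb (mdeg (N + N) b) D
                   then lprod (seq 0 (N + N)) (fun i => falling (a i / 2) (b i / 2)) else 0) X.
Proof.
  set (K := (N + N)%nat). intros HE HH a.
  rewrite coef_pmul_sub, (tsum_ext _ (fun b => if mle K b a then sqsum_pow_coef K M (msub a b) else 0))
    by (intros b; destruct (mle K b a); auto; apply coef_sqsum_pow).
  rewrite (is_homog_tsum K D X); auto.
  2:{ intros b b' Hb. rewrite (mle_meq K b b' a Hb). destruct (mle K b' a); auto.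
      apply sqsum_pow_coef_meq. intros i Hi. unfold msub. rewrite Hb; auto. }
  rewrite <- tsum_scal. apply tsum_ext_in. intros t Ht.
  destruct (Nat.eqb_spec (mdeg K (snd t)) D) as [E|]; [|ring].
  apply sqsum_pow_coef_msub; auto.
Qed.

(* Sum of |c| over the listed terms, an upper bound for the l1 norm of the coefficients. *)
Definition l1norm (P : mpoly) : R := fold_right Rplus 0 (map (fun t => Rabs (fst t)) P).

Lemma l1norm_nonneg P : 0 <= l1norm P.
Proof. unfold l1norm; induction P; simpl; [lra|]. pose proof (Rabs_pos (fst a)). lra. Qed.

Lemma l1norm_app P Q : l1norm (P ++ Q) = l1norm P + l1norm Q.
Proof. unfold l1norm. rewrite map_app, fold_right_app. induction P; simpl; [lra|]. rewrite IHP. lra. Qed.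

Lemma l1norm_pscale c P : l1norm (pscale c P) = Rabs c * l1norm P.
Proof. unfold l1norm, pscale. induction P; simpl; [lra|]. rewrite IHP, Rabs_mult. ring. Qed.

Lemma tsum_diff_bound f g P T B : 0 <= B -> (forall t, In t P -> Rabs (f (snd t) - g (snd t)) * T <= B) ->
  0 <= T -> Rabs (tsum f P - tsum g P) * T <= l1norm P * B.
Proof.
  intros HB H HT. induction P as [|t P IH].
  - unfold tsum, l1norm; simpl. rewrite Rminus_diag, Rabs_R0. lra.
  - rewrite !tsum_cons. unfold l1norm; simpl. fold (l1norm P).
    replace (fst t * f (snd t) + tsum f P - (fst t * g (snd t) + tsum g P)) with
      (fst t * (f (snd t) - g (snd t)) + (tsum f P - tsum g P)) by ring.
    assert (H1 : Rabs (fst t) * (Rabs (f (snd t) - g (snd t)) * T) <= Rabs (fst t) * B).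
    { apply Rmult_le_compat_l; [apply Rabs_pos| apply H; left; auto]. }
    assert (IH' := IH ltac:(intros; apply H; right; auto)).
    pose proof (Rabs_triang (fst t * (f (snd t) - g (snd t))) (tsum f P - tsum g P)).
    rewrite Rabs_mult in H0. nra.
Qed.

Lemma peval_sqrt_even_homog K D X (u : nat -> R) :
  even_exps K X -> is_homog K (2 * D) X -> (forall i, 0 <= u i) ->
  peval K X (fun i => sqrt (u i)) =
  tsum (fun b => if Nat.eqb (mdeg K b) (2 * D) then lprod (seq 0 K) (fun i => u i ^ (b i / 2)) else 0) X.
Proof.
  intros HE HH Hu. rewrite peval_tsum, (is_homog_tsum K (2 * D) X) by (auto; apply mon_eval_respects).
  apply tsum_ext_in. intros t Ht. destruct (Nat.eqb (mdeg K (snd t)) (2 * D)); auto.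
  unfold mon_eval, rprod. fold (lprod (seq 0 K) (fun i => sqrt (u i) ^ snd t i)).
  apply lprod_ext_in. intros i Hi. apply in_seq in Hi. destruct (HE t Ht i ltac:(lia)) as [v Hv].
  unfold mono in *. rewrite Hv, half_double. apply sqrt_pow_even, Hu.
Qed.

Lemma falling_tsum_close K D X (a : mono) T : even_exps K X -> 0 < T -> INR D <= T ->
  (forall i, (i < K)%nat -> INR (a i / 2) <= T) ->
  Rabs (tsum (fun b => if Nat.eqb (mdeg K b) (2 * D)
                       then lprod (seq 0 K) (fun i => INR (a i / 2) ^ (b i / 2)) else 0) X
        - tsum (fun b => if Nat.eqb (mdeg K b) (2 * D)
                         then lprod (seq 0 K) (fun i => falling (a i / 2) (b i / 2)) else 0) X) * T
  <= l1norm X * (INR D * INR D * T ^ D).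
Proof.
  intros HE HT HDT Ha.
  assert (HB : 0 <= INR D * INR D * T ^ D) by (apply Rmult_le_pos; [apply Rmult_le_pos; apply pos_INR| apply pow_le; lra]).
  apply tsum_diff_bound; [auto| |lra].
  intros t Ht. destruct (Nat.eqb_spec (mdeg K (snd t)) (2 * D)) as [E|]; [|rewrite Rminus_diag, Rabs_R0, Rmult_0_l; auto].
  assert (Hsb : fold_right Nat.add 0%nat (map (fun i => (snd t i / 2)%nat) (seq 0 K)) = D).
  { pose proof (fold_half (seq 0 K) (snd t) ltac:(intros i Hi; apply in_seq in Hi;
       destruct (HE t Ht i ltac:(lia)) as [v Hv]; apply Nat.even_spec; exists v; exact Hv)).
    unfold mdeg in E. lia. }
  destruct (lprod_falling_close (seq 0 K) (fun i => (a i / 2)%nat) (fun i => (snd t i / 2)%nat) T D HT HDT)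
    as [_ [_ Hc]]; [|rewrite Hsb in Hc; exact Hc].
  intros i Hi. split; [apply Ha; apply in_seq in Hi; lia|].
  rewrite <- Hsb. apply (fold_le_in (seq 0 K) (fun i => (snd t i / 2)%nat)). auto.
Qed.

(* Polya's estimate: the falling-factorial sum is within O(D^2 T^(D-1)) of X evaluated at sqrt(a/2),
   whose size is at least rho T^D with T = M + D. *)
Lemma polya_coef_nonneg N X M D (a : mono) rho :
  even_exps (N + N) X -> is_homog (N + N) (2 * D) X -> (0 < D)%nat -> even_mono (N + N) a = true ->
  mdeg (N + N) a = (2 * M + 2 * D)%nat ->
  rho * INR (M + D) ^ D <= peval (N + N) X (fun i => sqrt (INR (a i / 2))) ->
  l1norm X * INR D * INR D < rho * INR (M + D) ->
  0 <= tsum (fun b => if Nat.eqb (mdeg (N + N) b) (2 * D)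
                   then lprod (seq 0 (N + N)) (fun i => falling (a i / 2) (b i / 2)) else 0) X.
Proof.
  set (K := (N + N)%nat). intros HE HH HD Ea Hma Hpsi Herr.
  set (T := INR (M + D)) in *.
  assert (HT : 0 < T) by (unfold T; apply lt_0_INR; lia).
  assert (HDT : INR D <= T) by (unfold T; apply le_INR; lia).
  assert (Ha : forall i, (i < K)%nat -> INR (a i / 2) <= T).
  { intros i Hi. apply Rle_trans with (rsum K (fun i => INR (a i / 2))).
    - apply (rsum_ge_term K (fun i => INR (a i / 2))); auto. intros; apply pos_INR.
    - right. apply rsum_half_mdeg; auto. lia. }
  pose proof (falling_tsum_close K D X a T HE HT HDT Ha) as Hb.
  rewrite <- (peval_sqrt_even_homog K D X) in Hb by (auto; intros; apply pos_INR).
  set (Phi := tsum _ X) in *. set (Psi := peval K X _) in *.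
  assert (Hpos : 0 < T ^ D) by (apply pow_lt; lra).
  assert (l1norm X * INR D * INR D * T ^ D < rho * T * T ^ D) by (apply Rmult_lt_compat_r; auto).
  assert ((Psi - Phi) * T <= Rabs (Psi - Phi) * T) by (apply Rmult_le_compat_r; [lra| apply Rle_abs]).
  nra.
Qed.

(** * The certificate *)

Definition vw_sqdiff (N i : nat) : mpoly := psub (ppow (pvar i) 2) (ppow (pvar (N + i)) 2).

Definition cert_A (N d : nat) : mpoly := ppow (psum N (fun i => ppow (vw_sqdiff N i) 2)) (2 * d).

Definition cert_B (N d : nat) : mpoly :=
  ppow (psum N (fun i => padd (ppow (pvar i) 4) (ppow (pvar (N + i)) 4))) (2 * d).

Definition cert_factor (N d : nat) (hq : mpoly) (r : nat) : mpoly :=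
  padd (psub hq (pscale (/ INR r) (cert_A N d))) (pscale (/ (2 * INR r)) (cert_B N d)).

Lemma cert_unfold n m p g Rb eta beta r :
  cert n m p g Rb eta beta r =
  pmul (cert_factor (n + m + 3) (dd n m p g) (psubst (n + m + 3) (hform n m p g Rb eta beta) (vw_sqdiff (n + m + 3))) r)
       (ppow (sqsum (n + m + 3)) (r * r)).
Proof. reflexivity. Qed.

Lemma even_exps_vw_sqdiff K N i : even_exps K (vw_sqdiff N i).
Proof. apply even_exps_psub; apply even_exps_pvar2. Qed.

Lemma even_exps_cert_factor N d hq r : even_exps (N + N) hq -> even_exps (N + N) (cert_factor N d hq r).
Proof.
  intros H. unfold cert_factor, cert_A, cert_B. apply even_exps_padd; [apply even_exps_psub|]; auto; apply even_exps_pscale; apply even_exps_ppow, even_exps_psum.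
  - intros i. apply even_exps_ppow, even_exps_vw_sqdiff.
  - intros i. apply even_exps_padd; apply even_exps_pvar4.
Qed.

Lemma is_homog_vw_sqdiff N i : (i < N)%nat -> is_homog (N + N) 2 (vw_sqdiff N i).
Proof. intros Hi. apply is_homog_psub; apply is_homog_pvarpow; lia. Qed.

Lemma is_homog_cert_factor N d hq r : is_homog (N + N) (2 * (4 * d)) hq -> is_homog (N + N) (2 * (4 * d)) (cert_factor N d hq r).
Proof.
  intros H. unfold cert_factor, cert_A, cert_B. apply is_homog_padd; [apply is_homog_psub|]; auto; apply is_homog_pscale.
  - apply (is_homog_eq _ (2 * d * 4)); [lia|]. apply is_homog_ppow, is_homog_psum. intros i Hi.
    apply (is_homog_eq _ (2 * 2)); [lia|]. apply is_homog_ppow, is_homog_vw_sqdiff; auto.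
  - apply (is_homog_eq _ (2 * d * 4)); [lia|]. apply is_homog_ppow, is_homog_psum. intros i Hi.
    apply is_homog_padd; apply is_homog_pvarpow; lia.
Qed.

Lemma l1norm_cert_factor N d hq r : (1 <= r)%nat -> l1norm (cert_factor N d hq r) <= l1norm hq + l1norm (cert_A N d) + l1norm (cert_B N d).
Proof.
  intros Hr. unfold cert_factor, padd, psub. rewrite !l1norm_app, !l1norm_pscale.
  assert (1 <= INR r) by (apply (le_INR 1); auto).
  pose proof (l1norm_nonneg (cert_A N d)). pose proof (l1norm_nonneg (cert_B N d)).
  replace (Rabs (-1)) with 1 by (rewrite Rabs_left by lra; ring). rewrite Rabs_right by (apply Rle_ge; left; apply Rinv_0_lt_compat; lra).
  rewrite Rabs_right by (apply Rle_ge; left; apply Rinv_0_lt_compat; lra).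
  assert (/ INR r <= 1) by (rewrite <- Rinv_1; apply Rinv_le_contravar; lra).
  assert (/ (2 * INR r) <= 1) by (rewrite <- Rinv_1; apply Rinv_le_contravar; lra).
  assert (0 <= / INR r) by (left; apply Rinv_0_lt_compat; lra).
  assert (0 <= / (2 * INR r)) by (left; apply Rinv_0_lt_compat; lra).
  nra.
Qed.

Lemma peval_vw_sqdiff N i w : (i < N)%nat ->
  peval (N + N) (vw_sqdiff N i) w = w i ^ 2 - w (N + i)%nat ^ 2.
Proof. intros Hi. unfold vw_sqdiff. rewrite peval_psub, !peval_pvar_pow by lia. reflexivity. Qed.

Lemma peval_sqsum N w : peval (N + N) (sqsum N) w = rsum N (fun i => w i ^ 2 + w (N + i)%nat ^ 2).
Proof.
  unfold sqsum. rewrite peval_padd, !peval_psum, <- rsum_add. apply rsum_ext_in. intros i Hi.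
  rewrite !peval_pvar_pow by lia. reflexivity.
Qed.

Lemma peval_cert_factor N d H r w :
  let q i := w i ^ 2 - w (N + i)%nat ^ 2 in
  peval (N + N) (cert_factor N d (psubst N H (vw_sqdiff N)) r) w =
    peval N H q - / INR r * rsum N (fun i => q i ^ 2) ^ (2 * d)
    + / (2 * INR r) * rsum N (fun i => w i ^ 4 + w (N + i)%nat ^ 4) ^ (2 * d).
Proof.
  intros q. unfold cert_factor, cert_A, cert_B.
  rewrite peval_padd, peval_psub, !peval_pscale, peval_psubst, !peval_ppow, !peval_psum.
  rewrite (peval_ext N H _ q) by (intros; apply peval_vw_sqdiff; auto).
  rewrite (rsum_ext_in N _ (fun i => q i ^ 2)) by (intros; rewrite peval_ppow, peval_vw_sqdiff; auto).
  rewrite (rsum_ext_in N (fun i => peval (N + N) (padd _ _) w) (fun i => w i ^ 4 + w (N + i)%nat ^ 4))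
    by (intros; rewrite peval_padd, !peval_pvar_pow by lia; reflexivity).
  reflexivity.
Qed.

(* Once h dominates c |z|^{4d} and 1/r <= c, the perturbation -(1/r)|z|^{4d} keeps h(v^2-w^2) nonnegative,
   and the last term of the factor is bounded below by Cauchy-Schwarz. *)
Lemma cert_factor_lower_bound N d H r c : (0 < N)%nat -> (1 <= r)%nat -> / INR r <= c ->
  (forall z, c * rsum N (fun i => z i ^ 2) ^ (2 * d) <= peval N H z) ->
  forall w, / (2 * INR r * INR (N + N) ^ (2 * d)) * rsum (N + N) (fun i => w i ^ 2) ^ (4 * d)
            <= peval (N + N) (cert_factor N d (psubst N H (vw_sqdiff N)) r) w.
Proof.
  intros HN Hr Hrc Hlow w. rewrite peval_cert_factor. cbv zeta.
  set (q := fun i => w i ^ 2 - w (N + i)%nat ^ 2).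
  set (Q := rsum N (fun i => q i ^ 2) ^ (2 * d)).
  set (S2 := rsum (N + N) (fun i => w i ^ 2)).
  set (S4 := rsum N (fun i => w i ^ 4 + w (N + i)%nat ^ 4)).
  assert (HrR : 1 <= INR r) by (apply (le_INR 1); auto).
  assert (HK : 0 < INR (N + N)) by (apply lt_0_INR; lia).
  assert (HQ : 0 <= Q) by (apply pow_le, rsum_sq_nonneg).
  assert (Hh : / INR r * Q <= peval N H q).
  { specialize (Hlow q). fold Q in Hlow. assert (/ INR r * Q <= c * Q) by (apply Rmult_le_compat_r; auto). lra. }
  assert (HCS : S2 ^ 2 / INR (N + N) <= S4).
  { unfold S4. rewrite (rsum_ext_in N _ (fun i => (w i ^ 2) ^ 2 + (w (N + i)%nat ^ 2) ^ 2)) by (intros; ring).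
    rewrite rsum_add, <- rsum_split. apply sq_rsum_le. lia. }
  assert (HCS' : (S2 ^ 2 / INR (N + N)) ^ (2 * d) <= S4 ^ (2 * d)).
  { apply pow_incr. split; auto. apply Rmult_le_pos; [apply pow2_ge_0| left; apply Rinv_0_lt_compat; auto]. }
  assert (Hpow : (S2 ^ 2 / INR (N + N)) ^ (2 * d) = S2 ^ (4 * d) / INR (N + N) ^ (2 * d)).
  { unfold Rdiv. rewrite Rpow_mult_distr, pow_inv, <- pow_mult. f_equal. f_equal. lia. }
  assert (Hinv : 0 < / (2 * INR r)) by (apply Rinv_0_lt_compat; lra).
  assert (/ (2 * INR r) * (S2 ^ (4 * d) / INR (N + N) ^ (2 * d)) <= / (2 * INR r) * S4 ^ (2 * d)).
  { apply Rmult_le_compat_l; lra. }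
  replace (/ (2 * INR r * INR (N + N) ^ (2 * d)) * S2 ^ (4 * d))
    with (/ (2 * INR r) * (S2 ^ (4 * d) / INR (N + N) ^ (2 * d)))
    by (field; split; [apply pow_nonzero|]; lra).
  change (rsum N (fun i => (w i ^ 2 - w (N + i)%nat ^ 2) ^ 2) ^ (2 * d)) with Q. lra.
Qed.

(* The exponent r^2 of the multiplier grows faster than the O(r) error of Polya's estimate. *)
Lemma cert_nonneg_coefs_of_pos n m p g Rb eta beta : (forall x, inS n m g x -> 0 < peval n p x) ->
  exists r, (1 <= r)%nat /\ has_nonneg_coefs (2 * (n + m + 3)) (cert n m p g Rb eta beta r).
Proof.
  intros Hpos.
  set (d := dd n m p g). set (N := (n + m + 3)%nat).
  set (hq := psubst N (hform n m p g Rb eta beta) (vw_sqdiff N)).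
  assert (Hd : (1 <= d)%nat) by apply dd_ge1.
  assert (HH : is_homog N (2 * (2 * d)) (hform n m p g Rb eta beta))
    by (apply (is_homog_eq _ (4 * d)); [lia| apply is_homog_hform]).
  destruct (posdef_form_lower_bound N (2 * d) _ ltac:(lia) HH (hform_posdef n m p g Rb eta beta Hpos))
    as [c [Hc Hlow]].
  set (C0 := l1norm hq + l1norm (cert_A N d) + l1norm (cert_B N d)).
  set (rho r := / (2 * INR r * INR (N + N) ^ (2 * d))).
  set (W := 2 * C0 * INR (4 * d) * INR (4 * d) * INR (N + N) ^ (2 * d)).
  destruct (large_nat_exists c W Hc) as [r [Hr1 [Hrc HWr]]].
  assert (HrR : 1 <= INR r) by (apply (le_INR 1); auto).
  exists r. split; auto. intros a.
  rewrite cert_unfold. fold d N. fold hq. replace (2 * N)%nat with (N + N)%nat by lia.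
  set (X := cert_factor N d hq r).
  assert (HEv : even_exps (N + N) X) by (apply even_exps_cert_factor, even_exps_psubst; intros; apply even_exps_vw_sqdiff).
  assert (HHx : is_homog (N + N) (2 * (4 * d)) X).
  { apply is_homog_cert_factor, is_homog_psubst; [apply is_homog_hform| intros; apply is_homog_vw_sqdiff; auto]. }
  rewrite (coef_mul_sqsum_pow N X (r * r) (2 * (4 * d)) HEv HHx a).
  destruct (even_mono (N + N) a) eqn:Ea; [|simpl; lra].
  destruct (Nat.eqb_spec (mdeg (N + N) a) (2 * (r * r) + 2 * (4 * d))) as [Hma|]; [|simpl; lra].
  apply Rmult_le_pos; [apply Rmult_le_pos; [apply pos_INR| left; apply Rinv_0_lt_compat, half_fact_pos]|].
  apply (polya_coef_nonneg N X (r * r) (4 * d) a (rho r) HEv HHx ltac:(lia) Ea Hma).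
  - rewrite <- (rsum_half_mdeg (N + N) a (r * r + 4 * d)) by (auto; lia).
    eapply Rle_trans; [|apply (cert_factor_lower_bound N d _ r c); auto; try lia].
    + right. unfold rho. f_equal. f_equal. apply rsum_ext_in. intros i _. rewrite pow2_sqrt; auto. apply pos_INR.
  - assert (HL : l1norm X <= C0) by (apply l1norm_cert_factor; auto).
    assert (HTT : INR r * INR r < INR (r * r + 4 * d)).
    { rewrite plus_INR, mult_INR. assert (0 < INR (4 * d)) by (apply lt_0_INR; lia). lra. }
    assert (HD4 : 0 <= INR (4 * d)) by apply pos_INR.
    assert (l1norm X * INR (4 * d) * INR (4 * d) <= C0 * INR (4 * d) * INR (4 * d)).
    { apply Rmult_le_compat_r; auto. apply Rmult_le_compat_r; auto. }
    assert (W * INR r < INR r * INR r) by (apply Rmult_lt_compat_r; lra).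
    unfold rho. set (K := 2 * INR r * INR (N + N) ^ (2 * d)).
    assert (HK : 0 < K) by (apply Rmult_lt_0_compat; [lra| apply pow_lt, lt_0_INR; lia]).
    apply (Rmult_lt_reg_r K); auto.
    replace (/ K * INR (r * r + 4 * d) * K) with (INR (r * r + 4 * d)) by (field; lra).
    unfold W, K in *. nra.
Qed.

Lemma ball_gap_le_hbound n m p g Rb eta beta
    (Hball : forall x, inS n m g x -> rsum n (fun i => x i ^ 2) <= Rb)
    (Heta : forall x, inS n m g x -> forall j, (j < m)%nat -> peval n (g j) x <= eta j)
    (Hbeta : forall x, inS n m g x -> - peval n p x <= beta) x :
  inS n m g x -> peval n p x <= 0 ->
  0 <= rsum n (fun i => x i ^ 2) + (- peval n p x + rsum m (fun j => peval n (g j) x)) <= hbound m Rb eta beta.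
Proof.
  intros Hx Hp. pose proof (rsum_sq_nonneg n x).
  assert (0 <= rsum m (fun j => peval n (g j) x)) by (apply rsum_nonneg; intros; apply Hx; auto).
  assert (rsum m (fun j => peval n (g j) x) <= rsum m eta) by (apply rsum_le; intros; apply Heta; auto).
  pose proof (Hball x Hx). pose proof (Hbeta x Hx). unfold hbound. lra.
Qed.

(* A point x of S with p(x) <= 0 yields a zero of h: take y = 1, s_0 = sqrt(-p(x)), s_j = sqrt(g_j(x)),
   and let s_{m+1}^{2d} absorb the gap in the ball constraint. *)
Lemma hform_zero_of_nonpos n m p g Rb eta beta
    (Hball : forall x, inS n m g x -> rsum n (fun i => x i ^ 2) <= Rb)
    (Heta : forall x, inS n m g x -> forall j, (j < m)%nat -> peval n (g j) x <= eta j)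
    (Hbeta : forall x, inS n m g x -> - peval n p x <= beta) x :
  inS n m g x -> peval n p x <= 0 ->
  exists z, z (n + m + 2)%nat = 1 /\ peval (n + m + 3) (hform n m p g Rb eta beta) z = 0.
Proof.
  intros Hx Hp.
  set (d := dd n m p g). set (N := (n + m + 3)%nat). set (yi := (n + m + 2)%nat).
  assert (Hd : (1 <= d)%nat) by apply dd_ge1.
  set (X0 := rsum n (fun i => x i ^ 2) + (- peval n p x + rsum m (fun j => peval n (g j) x))).
  assert (HX0 : 0 <= X0 <= hbound m Rb eta beta) by (apply ball_gap_le_hbound; auto).
  destruct (pow_root_exists (hbound m Rb eta beta ^ d - X0 ^ d) (2 * d)) as [s Hs]; [|lia|].
  { assert (X0 ^ d <= hbound m Rb eta beta ^ d) by (apply pow_incr; lra). lra. }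
  set (z := fun i => if Nat.ltb i n then x i else if Nat.eqb i n then sqrt (- peval n p x)
                     else if Nat.ltb i (n + m + 1) then sqrt (peval n (g (i - n - 1)%nat) x)
                     else if Nat.eqb i (n + m + 1) then s else 1).
  assert (Hzx : forall i, (i < n)%nat -> z i = x i).
  { intros i Hi. unfold z. destruct (Nat.ltb_spec i n); [auto|lia]. }
  assert (Hz0 : z n ^ 2 = - peval n p x).
  { unfold z. destruct (Nat.ltb_spec n n); [lia|]. rewrite Nat.eqb_refl. apply pow2_sqrt. lra. }
  assert (Hzg : forall j, (j < m)%nat -> z (n + S j)%nat ^ 2 = peval n (g j) x).
  { intros j Hj. unfold z. destruct (Nat.ltb_spec (n + S j) n); [lia|].
    destruct (Nat.eqb_spec (n + S j) n); [lia|]. destruct (Nat.ltb_spec (n + S j) (n + m + 1)); [|lia].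
    replace (n + S j - n - 1)%nat with j by lia. apply pow2_sqrt. apply Hx; auto. }
  assert (Hzs : z (n + S m)%nat = s).
  { unfold z. destruct (Nat.ltb_spec (n + S m) n); [lia|]. destruct (Nat.eqb_spec (n + S m) n); [lia|].
    destruct (Nat.ltb_spec (n + S m) (n + m + 1)); [lia|]. destruct (Nat.eqb_spec (n + S m) (n + m + 1)); [auto|lia]. }
  assert (Hzy : z yi = 1).
  { unfold z, yi. destruct (Nat.ltb_spec (n + m + 2) n); [lia|]. destruct (Nat.eqb_spec (n + m + 2) n); [lia|].
    destruct (Nat.ltb_spec (n + m + 2) (n + m + 1)); [lia|]. destruct (Nat.eqb_spec (n + m + 2) (n + m + 1)); [lia|auto]. }
  exists z. split; auto.
  unfold N. rewrite peval_hform. fold d yi N.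
  rewrite !peval_homog_1 by (auto; unfold yi, N; lia). rewrite Hzy, !pow1.
  rewrite (peval_ext n p z x Hzx), Hz0.
  rewrite (rsum_ext_in m _ (fun _ => 0)).
  2:{ intros j Hj. rewrite peval_homog_1 by (auto; unfold yi, N; lia). rewrite (peval_ext n (g j) z x Hzx), Hzg by auto. ring. }
  rewrite (rsum_ext_in n _ (fun i => x i ^ 2)) by (intros; rewrite Hzx; auto).
  rewrite rsum_S, Nat.add_0_r, Hz0, (rsum_ext_in m (fun j => z (n + S j)%nat ^ 2) _ Hzg).
  fold X0. rewrite Hzs, Hs, rsum_const. ring.
Qed.

(* Splitting z into positive and negative parts, v = sqrt z^+ and w = sqrt z^-, gives v^2 - w^2 = z and
   v^4 + w^4 = z^2, so the two correction terms of the certificate combine to -1/(2r) |z|^{4d}. *)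
Definition split_point (N : nat) (z : nat -> R) : nat -> R :=
  fun j => if Nat.ltb j N then sqrt (Rmax (z j) 0) else sqrt (Rmax (- z (j - N)%nat) 0).

Lemma split_point_nonneg N z j : 0 <= split_point N z j.
Proof. unfold split_point. destruct (Nat.ltb j N); apply sqrt_pos. Qed.

Lemma split_point_parts N z i : (i < N)%nat ->
  split_point N z i ^ 2 - split_point N z (N + i)%nat ^ 2 = z i /\
  split_point N z i ^ 4 + split_point N z (N + i)%nat ^ 4 = z i ^ 2 /\
  split_point N z i ^ 2 + split_point N z (N + i)%nat ^ 2 = Rabs (z i).
Proof.
  intros Hi. unfold split_point. destruct (Nat.ltb_spec i N); [|lia].
  destruct (Nat.ltb_spec (N + i) N); [lia|]. replace (N + i - N)%nat with i by lia.
  destruct (Rmax_pos_neg_parts (z i)) as [H1 [H2 [H3 [H4 H5]]]].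
  rewrite !pow2_sqrt by auto. rewrite !(sqrt_pow_even _ 2) by auto. auto.
Qed.

Lemma peval_cert_split_point n m p g Rb eta beta r z :
  let N := (n + m + 3)%nat in
  peval (N + N) (cert n m p g Rb eta beta r) (split_point N z) =
    (peval N (hform n m p g Rb eta beta) z - / (2 * INR r) * rsum N (fun i => z i ^ 2) ^ (2 * dd n m p g))
    * rsum N (fun i => Rabs (z i)) ^ (r * r).
Proof.
  intros N. rewrite cert_unfold. fold N. rewrite peval_pmul, peval_ppow, peval_sqsum, peval_cert_factor.
  rewrite (peval_ext N _ _ z) by (intros; apply split_point_parts; auto).
  rewrite (rsum_ext_in N (fun i => (_ - _) ^ 2) (fun i => z i ^ 2))
    by (intros i Hi; rewrite (proj1 (split_point_parts N z i Hi)); auto).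
  rewrite (rsum_ext_in N (fun i => _ ^ 4 + _ ^ 4) (fun i => z i ^ 2)) by (intros; apply split_point_parts; auto).
  rewrite (rsum_ext_in N (fun i => _ ^ 2 + _ ^ 2) (fun i => Rabs (z i))) by (intros; apply split_point_parts; auto).
  rewrite Rinv_mult. set (u := / INR r). field.
Qed.

Lemma pos_of_cert_nonneg_coefs n m p g Rb eta beta
    (Hball : forall x, inS n m g x -> rsum n (fun i => x i ^ 2) <= Rb)
    (Heta : forall x, inS n m g x -> forall j, (j < m)%nat -> peval n (g j) x <= eta j)
    (Hbeta : forall x, inS n m g x -> - peval n p x <= beta) r :
  (1 <= r)%nat -> has_nonneg_coefs (2 * (n + m + 3)) (cert n m p g Rb eta beta r) ->
  forall x, inS n m g x -> 0 < peval n p x.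
Proof.
  intros Hr Hcoef x Hx. apply Rnot_le_lt. intros Hp.
  set (N := (n + m + 3)%nat). set (yi := (n + m + 2)%nat).
  destruct (hform_zero_of_nonpos n m p g Rb eta beta Hball Heta Hbeta x Hx Hp) as [z [Hzy Hz]].
  assert (Hnn : 0 <= peval (N + N) (cert n m p g Rb eta beta r) (split_point N z)).
  { apply peval_nonneg_of_nonneg_coefs; [|apply split_point_nonneg].
    replace (N + N)%nat with (2 * (n + m + 3))%nat by (unfold N; lia). exact Hcoef. }
  unfold N in Hnn. rewrite peval_cert_split_point, Hz in Hnn. fold N in Hnn.
  assert (HrR : 0 < 2 * INR r) by (apply (le_INR 1) in Hr; simpl in Hr; lra).
  assert (H2 : 1 <= rsum N (fun i => z i ^ 2)).
  { rewrite <- (pow1 2), <- Hzy. apply (rsum_ge_term N (fun i => z i ^ 2) yi); [intros; apply pow2_ge_0| unfold yi, N; lia]. }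
  assert (H1 : 1 <= rsum N (fun i => Rabs (z i))).
  { rewrite <- Rabs_R1, <- Hzy. apply (rsum_ge_term N (fun i => Rabs (z i)) yi); [intros; apply Rabs_pos| unfold yi, N; lia]. }
  assert (0 < / (2 * INR r) * rsum N (fun i => z i ^ 2) ^ (2 * dd n m p g) * rsum N (fun i => Rabs (z i)) ^ (r * r)).
  { apply Rmult_lt_0_compat; [apply Rmult_lt_0_compat|]; [apply Rinv_0_lt_compat| apply pow_lt| apply pow_lt]; lra. }
  lra.
Qed.

Theorem corollary4p4 (n m : nat) (p : mpoly) (g : nat -> mpoly)
    (Rb : R) (eta : nat -> R) (beta : R)
    (HR : 0 < Rb)
    (Hball : forall x : nat -> R, inS n m g x -> rsum n (fun i => x i ^ 2) <= Rb)
    (Heta : forall x : nat -> R, inS n m g x ->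
              forall j, (j < m)%nat -> peval n (g j) x <= eta j)
    (Hbeta : forall x : nat -> R, inS n m g x -> - peval n p x <= beta) :
  (forall x : nat -> R, inS n m g x -> 0 < peval n p x) <->
  exists r : nat, (1 <= r)%nat /\
    has_nonneg_coefs (2 * (n + m + 3)) (cert n m p g Rb eta beta r).
Proof.
  split.
  - apply cert_nonneg_coefs_of_pos.
  - intros [r [Hr Hc]]. exact (pos_of_cert_nonneg_coefs n m p g Rb eta beta Hball Heta Hbeta r Hr Hc).
Qed.
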